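(* Let $T':X'\to X'$ be a probability preserving map on a probability space $(X',m')$. Let $(X,m)$ be a standard probability space, $T:X\to X$ an ergodic probability preserving map, and $\pi:X'\to X$ a map with countable fibers, such that $m=\pi_*(m')$ and $T\circ\pi=\pi\circ T'$. Let $f:X\to\mathbb{R}$ be measurable. Then: (i) the function $f$ is a coboundary for $T$ if and only if the function $f\circ\pi$ is a coboundary for $T'$; (ii) the function $f$ is aperiodic for $T$ if and only if the function $f\circ\pi$ is aperiodic for $T'$.
   Context: For a probability preserving map $T$ of $(X,m)$: a function $f:X\to\mathbb{R}$ is a coboundary for $T$ if there exists a measurable function $g:X\to\mathbb{R}$ such that $f=g-g\circ T$ almost everywhere. A function $f:X\to\mathbb{R}$ is periodic for $T$ if there exist $\rho\in\mathbb{R}$, $g:X\to\mathbb{R}$ measurable, $\lambda>0$ and $q:X\to\mathbb{Z}$ (measurable) such that $f=\rho+g-g\circ T+\lambda q$ almost everywhere; otherwise it is aperiodic for $T$. All maps are measurable. ''Countable fibers'' means that $\pi^{-1}(x)$ is at most countable for every $x\in X$.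
   Formalization: In (ii), the implication ''f aperiodic for T implies f∘π aperiodic for T''' is proved with (X',m') also assumed standard (isomorphic mod 0 to a Borel probability on the line); it fails for arbitrary probability spaces (X',m'). *)

(* Defs.v *)
From HB Require Import structures.
From mathcomp Require Import all_boot all_order all_algebra.
From mathcomp Require Import all_classical all_reals all_analysis.
From mathcomp Require Import measurable_realfun.
Set Implicit Arguments.
Unset Strict Implicit.
Unset Printing Implicit Defensive.
Import Order.TTheory GRing.Theory Num.Theory.
Local Open Scope classical_set_scope.
Local Open Scope ring_scope.

(* Only measurable B matter: a [probability] is a total function on [set X],
   unconstrained outside the sigma-algebra. *)
Definition measure_preserving (R : realType) (d d' : measure_display)
    (X : measurableType d) (Y : measurableType d')
    (m : probability X R) (mu : probability Y R) (h : X -> Y) : Prop :=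
  measurable_fun setT h /\
  forall B : set Y, measurable B -> m (h @^-1` B) = mu B.

Definition ergodic (R : realType) (d : measure_display)
    (X : measurableType d) (m : probability X R) (T : X -> X) : Prop :=
  measure_preserving m m T /\
  forall A : set X, measurable A -> T @^-1` A = A ->
    m A = 0%E \/ m A = 1%E.

(* (X, m) is isomorphic mod 0 to a Borel probability mu on the real line:
   phi is injective on a set X0 of full measure and sends the measurable
   subsets of X0 to sets measurable for the completion of mu.  This covers
   every Borel probability on a standard Borel space, and also completions of
   such spaces (Lebesgue-Rokhlin spaces). *)
Definition standard_probability (R : realType) (d : measure_display)
    (X : measurableType d) (m : probability X R) : Prop :=
  exists (mu : probability R R) (phi : X -> R) (X0 : set X),
    [/\ measure_preserving m mu phi,
        measurable X0,
        m X0 = 1%E,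
        {in X0 &, injective phi}
      & forall A : set X, measurable A -> A `<=` X0 ->
          completed_algebra_gen mu (phi @` A)].

Definition coboundary (R : realType) (d : measure_display)
    (X : measurableType d) (m : probability X R) (T : X -> X)
    (f : X -> R) : Prop :=
  exists g : X -> R, measurable_fun setT g /\
    {ae m, forall x, f x = g x - g (T x)}.

(* The integers carry the discrete sigma-algebra. *)
Definition periodic_for (R : realType) (d : measure_display)
    (X : measurableType d) (m : probability X R) (T : X -> X)
    (f : X -> R) : Prop :=
  exists (rho : R) (g : X -> R) (lambda : R) (q : X -> int),
    [/\ measurable_fun setT g,
        0 < lambda,
        forall B : set int, measurable (q @^-1` B)
      & {ae m, forall x, f x = rho + g x - g (T x) + lambda * (q x)%:~R}].

Definition aperiodic_for (R : realType) (d : measure_display)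
    (X : measurableType d) (m : probability X R) (T : X -> X)
    (f : X -> R) : Prop :=
  ~ periodic_for m T f.

(* Main.v *)
Require Import Defs.
From HB Require Import structures.
From mathcomp Require Import all_boot all_order all_algebra.
From mathcomp Require Import all_classical all_reals all_analysis.
From mathcomp Require Import measurable_realfun.
From mathcomp Require Import ring lra zify.
Set Implicit Arguments.
Unset Strict Implicit.
Unset Printing Implicit Defensive.
Import Order.TTheory GRing.Theory Num.Theory.
Import numFieldNormedType.Exports.
Local Open Scope classical_set_scope.
Local Open Scope ring_scope.

(** Solutions of the cohomological equation on [X] pull back along the factor
    map, so only the descent from [X'] to [X] has content.

    Coboundaries ([coboundary_descent]).  If [f o pi = g - g o T'], then the
    Birkhoff sums of [f] at [pi x] are [g x - g (T'^n x)].  By a maximal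
    inequality the orbit of almost every [x] stays, most of the time, where
    [|g|] is below some bound ([orbits_mostly_bounded]), so these sums stay most
    of the time in a bounded window and their median over all times [n] is
    finite.  This median is a function of [pi x] alone, and replacing [y] by
    [T y] shifts the sequence of sums at [y] by one time and by the constant
    [f y]: the median solves the cohomological equation on [X].

    Periodic functions ([periodic_descent]).  Let
    [f o pi = rho + g - g o T' + lambda q] and [a = 2 pi k / lambda] with [k >= 1].
    Composition with [T'] multiplies [exp (i a g)] by [exp (- i a (f o pi - rho))].
    The conditional expectation [E_k] of [exp (i a g)] given [pi] obeys the same
    law along [T]; this is a variance computation
    ([conditional_expectation_equivariant]).  So [|E_k|] is invariant, and by
    ergodicity [E_k] vanishes almost everywhere or almost nowhere.  If some [E_k]
    vanishes almost nowhere, then its argument divided by [a] is a transfer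
    function for [f], with period [lambda / k] ([periodic_of_equivariant]).

    It remains to exclude that [E_k = 0] for all [k >= 1].  In that case [g]
    modulo [lambda] is uniformly distributed on almost every fibre of [pi], and
    a Fejer kernel estimate bounds the joint law of [pi] and [g] modulo [lambda]
    by a multiple of the product of [m] and Lebesgue measure ([box_bound]).  By
    Lusin's theorem, part of positive measure of [X'] has a compact image under
    the pair formed by [pi] and [g] modulo [lambda].  As the fibres of [pi] are
    countable, the vertical sections of this compact set are countable, so the
    product measure does not charge it: a contradiction
    ([countable_fibres_not_uniform]). *)

(** * Measure preserving maps and ergodicity *)

Section measure_preserving_maps.
Context (R : realType) (d d' : measure_display).
Context (X : measurableType d) (Y : measurableType d').
Context (m : probability X R) (mu : probability Y R) (h : X -> Y).
Hypothesis hP : measure_preserving m mu h.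

Lemma mp_measurable (B : set Y) : measurable B -> measurable (h @^-1` B).
Proof. by move=> mB; rewrite -[X in measurable X]setTI; exact: (proj1 hP). Qed.

Lemma mp_ae (P : Y -> Prop) :
  {ae mu, forall y, P y} -> {ae m, forall x, P (h x)}.
Proof.
case: hP => mh hB [A [mA A0 PA]]; exists (h @^-1` A); split.
- by rewrite -[_ @^-1` _]setTI; exact: mh.
- by rewrite hB.
- by move=> x; exact: (PA (h x)).
Qed.

Lemma mp_ge0_integral (u : Y -> \bar R) :
  measurable_fun setT u -> (forall y, (0 <= u y)%E) ->
  (\int[m]_x u (h x) = \int[mu]_y u y)%E.
Proof.
case: hP => mh hB mu' u0.
transitivity (\int[pushforward m h]_y u y)%E.
  by rewrite ge0_integral_pushforward.
by apply: eq_measure_integral => A mA _; exact: hB.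
Qed.

Lemma mp_full (A : set Y) : measurable A ->
  {ae m, forall x, A (h x)} -> {ae mu, forall y, A y}.
Proof.
case: hP => mh hB mA hA; have mhA : measurable (h @^-1` ~` A).
  by rewrite -[X in measurable X]setTI; apply: mh => //; exact: measurableC.
exists (~` A); split => //; first exact: measurableC.
by rewrite -hB; [exact: (measure_negligible mhA)|exact: measurableC].
Qed.

End measure_preserving_maps.

Section ergodicity.
Context (R : realType) (d : measure_display).
Context (X : measurableType d) (m : probability X R) (T : X -> X).

Lemma mp_iter : measure_preserving m m T ->
  forall k, measure_preserving m m (iter k T).
Proof.
move=> [mT hT]; elim=> [|k [mk hk]]; first by split=> //; exact: measurable_id.
split=> [|B mB]; first exact: (measurableT_comp mT mk).
have mTB : measurable (T @^-1` B) by rewrite -[X in measurable X]setTI; exact: mT.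
by rewrite -[LHS]/(m (iter k T @^-1` (T @^-1` B))) hk// hT.
Qed.

Lemma mp_ae_orbit (P : X -> Prop) : measure_preserving m m T ->
  {ae m, forall x, P x} -> {ae m, forall x, forall k, P (iter k T x)}.
Proof.
move=> hT hP; apply: ae_foralln => k; exact: (mp_ae (mp_iter hT k)).
Qed.

(** Ergodicity speaks of strictly invariant sets.  The set of points whose orbit
    visits [A] infinitely often is strictly invariant, and it differs from [A]
    by a null set. *)
Lemma ergodic_ae_invariant (A : set X) : ergodic m T -> measurable A ->
  {ae m, forall x, A x <-> A (T x)} ->
  {ae m, forall x, ~ A x} \/ {ae m, forall x, A x}.
Proof.
move=> [hT erg] mA /(mp_ae_orbit hT) invA.
pose B := [set x | forall n, exists2 k, (n <= k)%N & A (iter k T x)].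
have BE : B = \bigcap_n \bigcup_(k in [set k | (n <= k)%N]) iter k T @^-1` A.
  apply/seteqP; split => [x Bx n _|x Bx n].
    by have [k nk Ak] := Bx n; exists k.
  by have [k nk Ak] := Bx n I; exists k.
have mB : measurable B.
  rewrite BE; apply: bigcapT_measurable => n; apply: bigcup_measurable => k _.
  by rewrite -[X in measurable X]setTI; apply: (mp_iter hT k).1.
have TB : T @^-1` B = B.
  apply/seteqP; split=> x Bx n /=.
    have [k nk Ak] := Bx n; exists k.+1; first exact: leqW.
    by rewrite iterSr.
  have [[//|k] nk Ak] := Bx n.+1; exists k => //.
  by rewrite -iterSr.
have AB : {ae m, forall x, A x <-> B x}.
  apply: filterS invA => x Ax.
  have Ak k : A x <-> A (iter k T x).
    by elim: k => [//|k IH]; rewrite IH /= -Ax.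
  split=> [xA n|/(_ 0%N)[k _]]; first by exists n => //; apply/Ak.
  by rewrite -Ak.
case: (erg B mB TB) => mB01; [left|right].
  have nB : {ae m, forall x, ~ B x} by exists B; split => // x /= /contrapT.
  by apply: filterS2 AB nB => x ->.
have yB : {ae m, forall x, B x}.
  exists (~` B); split => //; first exact: measurableC.
  by rewrite probability_setC// mB01 subee.
by apply: filterS2 AB yB => x ->.
Qed.

End ergodicity.

Section easy_direction.
Context (R : realType) (d d' : measure_display)
    (X' : measurableType d') (m' : probability X' R) (T' : X' -> X')
    (X : measurableType d) (m : probability X R) (T : X -> X)
    (pi : X' -> X) (f : X -> R).
Hypothesis hpi : measure_preserving m' m pi.
Hypothesis hcomm : T \o pi = pi \o T'.

Let commE x : T (pi x) = pi (T' x).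
Proof. exact: (congr1 (fun u => u x) hcomm). Qed.

Lemma coboundary_comp : coboundary m T f -> coboundary m' T' (f \o pi).
Proof.
move=> [g [mg fg]]; exists (g \o pi); split.
  by apply: measurableT_comp => //; exact: hpi.1.
by apply: filterS (mp_ae hpi fg) => x /=; rewrite commE.
Qed.

Lemma periodic_comp : periodic_for m T f -> periodic_for m' T' (f \o pi).
Proof.
move=> [rho [g [lambda [q [mg l0 mq fg]]]]].
exists rho, (g \o pi), lambda, (q \o pi); split => //.
- by apply: measurableT_comp => //; exact: hpi.1.
- move=> B; rewrite comp_preimage -[X in measurable X]setTI.
  by case: hpi => mpi _; exact: mpi.
- by apply: filterS (mp_ae hpi fg) => x /=; rewrite commE.
Qed.

End easy_direction.

(** * A maximal inequality *)

Lemma measurable_ltr_set (R : realType) (d : measure_display)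
    (X : measurableType d) (f g : X -> R) :
  measurable_fun setT f -> measurable_fun setT g ->
  measurable [set x | f x < g x].
Proof.
move=> mf mg; have := measurable_fun_ltr mf mg measurableT (Y := [set true]).
by rewrite setTI; apply.
Qed.

Section maximal_inequality.
Context (R : realType) (d : measure_display) (X : measurableType d).
Context (m : probability X R) (T : X -> X) (E : set X).
Hypothesis hT : measure_preserving m m T.
Hypothesis mE : measurable E.

(** The maximum over [k <= n] of three times the number of visits to [E] before
    time [k], minus [k].  The recursion splits off the first step of the orbit. *)
Fixpoint max_excess (n : nat) (x : X) : R :=
  if n is n'.+1 then Num.max 0 (3 * \1_E x + max_excess n' (T x) - 1) else 0.

Definition visits (n : nat) (x : X) : nat := \sum_(k < n) (iter k T x \in E).

Lemma visits_le_max_excess n x :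
  3 * (visits n x)%:R <= n%:R + max_excess n x.
Proof.
elim: n x => [|n IH] x; first by rewrite /visits big_ord0 /= mulr0 addr0.
have -> : visits n.+1 x = ((x \in E) + visits n (T x))%N.
  rewrite /visits big_ord_recl; congr addn; apply: eq_bigr => i _.
  by rewrite -iterSr.
have := IH (T x); rewrite /= indicE natrD -[n.+1]addn1 natrD.
by rewrite maxElt; case: ltP; lra.
Qed.

Lemma max_excess_homo n x : max_excess n x <= max_excess n.+1 x.
Proof.
elim: n x => [|n IH] x; first by rewrite /= le_max lexx.
rewrite [leLHS]/= ge_max; apply/andP; split.
  by rewrite [leRHS]/= le_max lexx.
have h := IH (T x).
rewrite -[leRHS]/(Num.max 0 (3 * \1_E x + max_excess n.+1 (T x) - 1)).
by rewrite le_max lerD2r lerD2l h orbT.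
Qed.

Lemma max_excess_ge0 n x : 0 <= max_excess n x.
Proof. by case: n => [|n] //=; rewrite le_max lexx. Qed.

Lemma max_excess_bound n x : max_excess n x <= 2 * n%:R.
Proof.
elim: n x => [x|n IH x] /=; first by rewrite mulr0.
have := IH (T x); have := ler0n R n; have : \1_E x <= 1 :> R by rewrite indicE lern1 leq_b1.
by rewrite -[n.+1]addn1 natrD ge_max => ? ? ?; apply/andP; split; lra.
Qed.

Lemma measurable_max_excess n : measurable_fun setT (max_excess n).
Proof.
elim: n => [|n IH] /=; first exact: measurable_cst.
have mT : measurable_fun setT (max_excess n \o T).
  by apply: measurableT_comp => //; case: hT.
apply: measurable_maxr => //; apply: measurable_funB => //.
apply: measurable_funD => //; apply: measurable_funM => //.
Qed.

Definition excessive (n : nat) : set X := [set x | 0 < max_excess n x].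

Lemma measurable_excessive n : measurable (excessive n).
Proof. by apply: measurable_ltr_set => //; exact: measurable_max_excess. Qed.

(** Where [max_excess n.+1] is positive it equals
    [3 * \1_E + max_excess n \o T - 1].  After integration the two excesses
    cancel, because [max_excess] increases with [n] and [T] preserves [m]; what
    is left of the [- 1] is the measure on the left-hand side. *)
Lemma maximal_inequality_step n : (m (excessive n.+1) <= 3%:E * m E)%E.
Proof.
have mM k : measurable_fun setT (fun x => (max_excess k x)%:E).
  by apply/measurable_EFinP; exact: measurable_max_excess.
have mA := measurable_excessive n.+1.
have M0 k x : (0 <= (max_excess k x)%:E)%E by rewrite lee_fin max_excess_ge0.
have fin : (\int[m]_x (max_excess n x)%:E)%E \is a fin_num.
  rewrite ge0_fin_numE; last exact: integral_ge0.
  apply: (@le_lt_trans _ _ (\int[m]_x (2 * n%:R)%:E)%E); last first.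
    by rewrite integral_cst//= probability_setT mule1 ltry.
  apply: ge0_le_integral => // x _; rewrite lee_fin.
  exact: max_excess_bound.
have iA (A : set X) : measurable A -> (\int[m]_x (\1_A x)%:E = m A)%E.
  by move=> mA'; rewrite integral_indic// setIT.
have m1 (A : set X) : measurable A -> measurable_fun setT (fun x => (\1_A x)%:E : \bar R).
  by move=> mA'; apply/measurable_EFinP.
have i0 (A : set X) x : (0 <= (\1_A x)%:E :> \bar R)%E by rewrite lee_fin.
have key : (\int[m]_x (max_excess n x)%:E + m (excessive n.+1) <=
            3%:E * m E + \int[m]_x (max_excess n x)%:E)%E.
  rewrite -[in leRHS](mp_ge0_integral hT (u := EFin \o max_excess n))//=; last exact: mM.
  rewrite -!iA// -ge0_integralZl//; last exact: m1.
  have mT : measurable_fun setT (fun x => (max_excess n (T x))%:E).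
    exact: (measurableT_comp (mM n) (proj1 hT)).
  have m3 : measurable_fun setT (fun x => 3%:E * (\1_E x)%:E : \bar R)%E.
    by apply: emeasurable_funM => //; exact: m1.
  have p3 x : (0 <= 3%:E * (\1_E x)%:E :> \bar R)%E by exact: mule_ge0.
  rewrite -ge0_integralD//; [|exact: m1].
  rewrite -ge0_integralD//.
  apply: ge0_le_integral => //.
  - by move=> x _; exact: adde_ge0.
  - by apply: emeasurable_funD => //; exact: m1.
  - by apply: emeasurable_funD.
  move=> x _; rewrite -EFinM -!EFinD lee_fin.
  have h := max_excess_homo n x; have h0 := max_excess_ge0 n (T x).
  have e0 : 0 <= \1_E x :> R by [].
  have [xA|xA] := boolP (x \in excessive n.+1).
    rewrite [\1_(excessive _) x]indicE xA; move: xA; rewrite inE /excessive /=.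
    by move: h; rewrite /= lt_max ltxx /= maxElt; case: ifP; lra.
  rewrite [\1_(excessive _) x]indicE (negbTE xA) addr0.
  move: xA; rewrite notin_setE /excessive /= => /negP; rewrite -leNgt => xA.
  by apply: (le_trans (le_trans h xA)); lra.
have fin' := fin_num_measure m _ mE.
have fin2 := fin_num_measure m _ mA.
move: key; rewrite -(fineK fin) -(fineK fin') -(fineK fin2) -!EFinM -!EFinD !lee_fin.
by lra.
Qed.

(** By [visits_le_max_excess], the union contains every point whose orbit, up to
    some time, has visited [E] more than a third of the time. *)
Lemma maximal_inequality :
  (m (\bigcup_n excessive n) <= 3%:E * m E)%E.
Proof.
have mU := bigcupT_measurable _ measurable_excessive.
have nd : nondecreasing_seq excessive.
  apply/nondecreasing_seqP => n; apply/subsetPset => x /=.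
  by move=> h; exact: lt_le_trans h (max_excess_homo n x).
apply: cvge_to_le (nondecreasing_cvg_mu measurable_excessive mU nd) _.
apply: nearW => n /=; apply: le_trans (maximal_inequality_step n).
apply: le_measure; rewrite ?inE; [exact: measurable_excessive..|].
by apply/subsetPset; exact: nd.
Qed.

End maximal_inequality.

(** The maximal inequality is applied to [E = {N < |g|}], whose measure tends to 0
    as [N] grows. *)
Lemma orbits_mostly_bounded (R : realType) (d : measure_display)
    (X : measurableType d) (m : probability X R) (T : X -> X) (g : X -> R) :
  measure_preserving m m T -> measurable_fun setT g ->
  {ae m, forall x, exists N : R, forall n,
    (3 * visits T [set y | (N < `|g y|)%R] n x <= n)%N}.
Proof.
move=> hT mg; pose E (N : nat) := [set y | N%:R < `|g y|].
have mE N : measurable (E N).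
  by apply: measurable_ltr_set => //; exact: measurableT_comp.
pose B N := \bigcup_n excessive R T (E N) n : set X.
have mB N : measurable (B N).
  by apply: bigcupT_measurable => n; exact: (measurable_excessive hT (mE N)).
have cE : m (E n) @[n --> \oo] --> 0%E.
  have <- : m (\bigcap_n E n) = 0%E.
    rewrite -[RHS](measure0 m); congr (m _); apply/seteqP; split => // x Ex.
    have /lt_trans/(_ (truncnS_gt _)) := Ex (Num.truncn `|g x|).+1 I.
    by rewrite ltxx.
  apply: nonincreasing_cvg_mu => //.
  - by rewrite (le_lt_trans (probability_le1 _ _))// ltry.
  - exact: bigcapT_measurable.
  - apply/nonincreasing_seqP => n; apply/subsetPset => x /=.
    by apply: le_lt_trans; rewrite ler_nat.
exists (\bigcap_N B N); split; first exact: bigcapT_measurable.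
- apply/eqP; rewrite eq_le measure_ge0 andbT.
  have c3 : (3%:E * m (E n))%E @[n --> \oo] --> 0%E.
    by rewrite -[X in _ --> X](mule0 3%:E); apply: cvgeZl.
  apply: cvge_ge c3; apply: nearW => n.
  apply: le_trans (maximal_inequality hT (mE n)).
  apply: le_measure; rewrite ?inE; [exact: bigcapT_measurable|exact: mB|].
  by move=> x; exact.
- move=> x /= nx N _; apply: contrapT => nB; apply: nx; exists N%:R => n.
  rewrite -(ler_nat R) natrM.
  apply: le_trans (visits_le_max_excess R _ _ _ _) _.
  rewrite gerDl leNgt; apply/negP => h; apply: nB.
  by exists n.
Qed.

(** * The median of the Birkhoff sums *)

Section quantile_of_sums.
Context (R : realType) (d : measure_display) (X : measurableType d).
Context (T : X -> X) (f : X -> R).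

Definition birkhoff (n : nat) (x : X) : R := \sum_(k < n) f (iter k T x).

(** The times [k] at which the Birkhoff sum is at most [t] have upper density at
    least 1/2, up to a bounded defect [c] in the counts.  Allowing the defect
    makes the condition insensitive to the loss of one time, so that
    [often_below_shift] holds without error term. *)
Definition often_below (x : X) (t : R) : Prop :=
  exists c : nat, forall N : nat, exists2 n : nat, (N <= n)%N &
    (n <= 2 * (\sum_(k < n) (birkhoff k x <= t)%R) + c)%N.

Lemma birkhoffS n x : birkhoff n.+1 x = f x + birkhoff n (T x).
Proof.
rewrite /birkhoff big_ord_recl; congr (_ + _); apply: eq_bigr => i _.
by rewrite -iterSr.
Qed.

(** The sums at [T x] are those at [x], delayed by one time and shifted by [f x].
    The delay changes each count by at most 1. *)
Lemma often_below_shift x t : often_below (T x) t <-> often_below x (t + f x).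
Proof.
have E n : (\sum_(k < n) (birkhoff k (T x) <= t)%R)%N =
    (\sum_(k < n) (birkhoff k.+1 x <= t + f x)%R)%N.
  by apply: eq_bigr => i _; rewrite birkhoffS addrC lerD2r.
have S n : (\sum_(k < n.+1) (birkhoff k x <= t + f x)%R)%N =
    ((birkhoff 0 x <= t + f x)%R + (\sum_(k < n) (birkhoff k (T x) <= t)%R))%N.
  by rewrite big_ord_recl E.
have S' n : (\sum_(k < n.+1) (birkhoff k x <= t + f x)%R)%N =
    (\sum_(k < n) (birkhoff k x <= t + f x)%R + (birkhoff n x <= t + f x)%R)%N.
  by rewrite big_ord_recr.
split=> [] [c h].
  exists (c + 1)%N => N; have [n Nn nc] := h N; exists n.+1; first exact: leqW.
  by rewrite S; lia.
exists (c + 3)%N => N; have [n Nn nc] := h N; exists n => //.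
have := S n; rewrite S'.
have := leq_b1 (birkhoff 0 x <= t + f x)%R.
have := leq_b1 (birkhoff n x <= t + f x)%R.
by lia.
Qed.

Lemma often_below_homo x s t : s <= t -> often_below x s -> often_below x t.
Proof.
move=> st [c h]; exists c => N; have [n Nn nc] := h N; exists n => //.
apply: (leq_trans nc); rewrite leq_add2r leq_mul2l/=; apply: leq_sum => i _.
by case: (boolP (birkhoff i x <= s)) => // /le_trans/(_ st) ->.
Qed.

Definition median (x : X) : R := inf [set t | often_below x t].

(** As [often_below x] is upward closed, this says that the set whose infimum is
    [median x] is nonempty and bounded below. *)
Definition median_finite : set X :=
  [set x | (exists t, often_below x t) /\ (exists t, ~ often_below x t)].

(** By [often_below_shift] the sets defining the medians at [T x] and at [x] are
    translates of each other. *)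
Lemma median_equivariant x : median_finite x -> f x = median x - median (T x).
Proof.
move=> [[t1 h1] [t2 h2]].
have lb y : y \in [set t | often_below x t] -> t2 <= y.
  by rewrite inE => /= h; rewrite leNgt; apply/negP => /ltW /often_below_homo/(_ h).
have hi : has_inf [set t | often_below x t].
  by split; [exists t1|exists t2 => y /mem_set; exact: lb].
have -> : median (T x) = median x - f x; last by rewrite opprB addrC subrK.
rewrite /median.
have -> : [set t | often_below (T x) t] =
    [set s + t | s in [set t | often_below x t] & t in [set - f x]].
  apply/seteqP; split => t /=.
    by move/often_below_shift => h; exists (t + f x) => //; exists (- f x) => //; rewrite addrK.
  by move=> [u h [_ -> <-]]; apply/often_below_shift; rewrite subrK.
by rewrite inf_sumE// ?inf1//; exact: has_inf1.
Qed.

End quantile_of_sums.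

Section median_measurable.
Context (R : realType) (d : measure_display) (X : measurableType d).
Context (m : probability X R) (T : X -> X) (f : X -> R).
Hypothesis hT : measure_preserving m m T.
Hypothesis mf : measurable_fun setT f.

Lemma measurable_birkhoff n : measurable_fun setT (birkhoff T f n).
Proof.
apply: measurable_sum => i; apply: (measurableT_comp mf).
exact: (mp_iter hT i).1.
Qed.

Lemma measurable_often_below t : measurable [set x | often_below T f x t].
Proof.
pose cnt n x := (\sum_(k < n) (birkhoff T f k x <= t)%R)%N.
have mcnt n : measurable_fun setT (cnt n).
  elim: n => [|n IH].
    rewrite (_ : cnt 0%N = cst 0%N)//.
    by apply/funext => x; rewrite /cnt big_ord0.
  rewrite (_ : cnt n.+1 = fun x => (cnt n x + nat_of_bool (birkhoff T f n x <= t)%R)%N).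
    apply: measurable_fun_addn => //.
    apply: (@measurableT_comp _ _ _ _ _ _ nat_of_bool).
      by move=> _ Y mY.
    by apply: measurable_fun_ler => //; exact: measurable_birkhoff.
  by apply/funext => x; rewrite /cnt big_ord_recr.
rewrite (_ : [set x | _] = \bigcup_c \bigcap_N \bigcup_(n in [set n | (N <= n)%N])
    [set x | (n <= 2 * cnt n x + c)%N]); last first.
  apply/seteqP; split => x.
    move=> [c h]; exists c => // N _; have [n Nn nc] := h N.
    by exists n.
  move=> [c _ h]; exists c => N; have [n Nn nc] := h N I.
  by exists n.
apply: bigcupT_measurable => c; apply: bigcapT_measurable => N.
apply: bigcup_measurable => n _.
have : measurable_fun setT (fun x => (n <= cnt n x + cnt n x + c)%N).
  apply: measurable_fun_leq => //; apply: measurable_fun_addn => //.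
  exact: measurable_fun_addn.
move=> /(_ measurableT [set true] I); rewrite setTI.
rewrite (_ : _ @^-1` _ = [set x | (n <= 2 * cnt n x + c)%N])//.
by apply/seteqP; split => x /=; rewrite mul2n -addnn.
Qed.

Lemma median_finite_nat x : median_finite T f x <->
  (exists n, often_below T f x n%:R) /\ (exists n, ~ often_below T f x (- n%:R)).
Proof.
split=> [[[t1 h1] [t2 h2]]|[[n1 h1] [n2 h2]]]; last first.
  by split; [exists n1%:R|exists (- n2%:R)].
split.
  exists (Num.truncn `|t1|).+1; apply: often_below_homo h1.
  by rewrite (le_trans (ler_norm _))// ltW// truncnS_gt.
exists (Num.truncn `|t2|).+1 => h; apply: h2; apply: often_below_homo h.
by rewrite lerNl (le_trans (ler_norm _))// normrN ltW// truncnS_gt.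
Qed.

Lemma measurable_median_finite : measurable (median_finite T f).
Proof.
rewrite (_ : median_finite T f =
    (\bigcup_n [set x | often_below T f x n%:R]) `&`
    (\bigcup_n ~` [set x | often_below T f x (- n%:R)])).
  apply: measurableI; apply: bigcupT_measurable => n.
    exact: measurable_often_below.
  by apply: measurableC; exact: measurable_often_below.
apply/seteqP; split => x.
  by move/median_finite_nat => [[n1 h1] [n2 h2]]; split; [exists n1|exists n2].
by move=> [[n1 _ h1] [n2 _ h2]]; apply/median_finite_nat; split; [exists n1|exists n2].
Qed.

Lemma measurable_median : measurable_fun (median_finite T f) (median T f).
Proof.
move=> mD; apply: (measurability _ (RGenInftyO.measurableE R)) => //.
move=> _ [_ [c ->] <-].
rewrite (_ : _ `&` _ = median_finite T f `&` \bigcup_(q : rat)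
  (if ratr q < c :> R then [set x | often_below T f x (ratr q)] else set0)).
  apply: measurableI => //; apply: bigcupT_measurable_rat => q.
  by case: ifP => // _; exact: measurable_often_below.
apply/seteqP; split => x [Dx].
  rewrite /= in_itv /= /median => /inf_lt[|t h tc]; first exact: Dx.1.
  split=> //; have [q] := rat_in_itvoo tc; rewrite in_itv /= => /andP[tq qc].
  by exists q => //; rewrite qc; apply: often_below_homo h; exact: ltW.
move=> [q _]; case: ifP => // qc h; split => //=; rewrite in_itv /=.
apply: le_lt_trans qc; apply: ge_inf => //.
have [t ht] := Dx.2; exists t => y /= hy.
by rewrite leNgt; apply/negP => /ltW /often_below_homo/(_ hy).
Qed.

Lemma median_finite_invariant x : median_finite T f x -> median_finite T f (T x).
Proof.
move=> [[t1 h1] [t2 h2]]; split.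
  by exists (t1 - f x); apply/often_below_shift; rewrite subrK.
by exists (t2 - f x) => /often_below_shift; rewrite subrK.
Qed.

Lemma coboundary_of_median_finite :
  {ae m, forall x, median_finite T f x} -> coboundary m T f.
Proof.
move=> D1; exists (median T f \_ (median_finite T f)); split.
  apply/(measurable_restrictT _ measurable_median_finite).
  exact: measurable_median.
apply: filterS D1 => x Dx.
rewrite !patchE mem_set// mem_set; last exact: median_finite_invariant.
exact: median_equivariant.
Qed.

End median_measurable.

(** At almost every [x] of [X'] the sums telescope: the sum up to time [k] at
    [pi x] is [g x - g (T'^k x)].  It lies within [N] of [g x] whenever
    [|g (T'^k x)| <= N], which holds for two thirds of the times, more than the
    half of them that decides where the median is. *)
Lemma coboundary_descent (R : realType) (d d' : measure_display)
    (X' : measurableType d') (m' : probability X' R) (T' : X' -> X')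
    (X : measurableType d) (m : probability X R) (T : X -> X)
    (pi : X' -> X) (f : X -> R)
    (hT' : measure_preserving m' m' T') (hT : measure_preserving m m T)
    (hpi : measure_preserving m' m pi) (hcomm : T \o pi = pi \o T')
    (hf : measurable_fun setT f) :
  coboundary m' T' (f \o pi) -> coboundary m T f.
Proof.
move=> [g [mg /(mp_ae_orbit hT') fg]].
apply: coboundary_of_median_finite => //.
apply: (mp_full hpi); first exact: (measurable_median_finite hT hf).
apply: filterS2 fg (orbits_mostly_bounded hT' mg) => x fx [N].
set E := [set y | _] => hN /=.
have iterE k : iter k T (pi x) = pi (iter k T' x).
  elim: k => [//|k /= ->]; exact: (congr1 (fun u => u _) hcomm).
have {}fx k : f (pi (iter k T' x)) = g (iter k T' x) - g (iter k.+1 T' x) := fx k.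
have SE k : birkhoff T f k (pi x) = g x - g (iter k T' x).
  rewrite /birkhoff; elim: k => [|k IH]; first by rewrite big_ord0 subrr.
  by rewrite big_ord_recr /= IH iterE fx addrA subrK.
have inE' y : (y \in E) = (N < `|g y|).
  by apply/idP/idP => [/set_mem|h]; [|apply/mem_set].
split.
  (* at good times, two thirds of all, the sum is at most [g x + N] *)
  exists (g x + N); exists 0%N => n0; exists n0 => //.
  set cnt := (\sum_(k < _) _)%N.
  have : (\sum_(k < n0) 1 <= cnt + visits T' E n0 x)%N.
    rewrite -big_split /=.
    apply: leq_sum => k _; rewrite SE inE'.
    have [//|h] := leP (g x - _) (g x + N).
    by have -> // : N < `|g (iter k T' x)|; rewrite ltr_normr; apply/orP; right; lra.
  by have := hN n0; rewrite sum1_card card_ord; lia.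
(* only the bad times, a third of all, have their sum below [g x - N - 1]; the
   defect [c] cannot compensate for this beyond time [3 c] *)
exists (g x - N - 1) => -[c hc]; have [n nc] := hc (3 * c + 1)%N.
set cnt := (\sum_(k < _) _)%N.
have : (cnt <= visits T' E n x)%N.
  apply: leq_sum => k _; rewrite SE inE'.
  have [h|//] := leP (g x - _) (g x - N - 1).
  by have -> // : N < `|g (iter k T' x)|; rewrite ltr_normr; apply/orP; left; lra.
by have := hN n; lia.
Qed.

(** * Integrals of bounded measurable functions *)

Section bounded_measurable.
Context (R : realType) (d : measure_display) (X : measurableType d).
Context (m : probability X R).
Implicit Types u v : X -> R.

(** A class of functions that is stable under ring operations and composition
    with measurable maps, and on which integrals are finite and linear without
    side conditions. *)
Definition bounded_measurable u :=
  measurable_fun setT u /\ exists M : R, forall x, `|u x| <= M.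

Lemma bmf_cst r : bounded_measurable (fun=> r).
Proof. by split; [exact: measurable_cst|exists `|r|]. Qed.

Lemma bmfD u v : bounded_measurable u -> bounded_measurable v ->
  bounded_measurable (fun x => u x + v x).
Proof.
move=> [mu [M uM]] [mv [N vN]]; split; first exact: measurable_funD.
by exists (M + N) => x; apply: le_trans (ler_normD _ _) _; exact: lerD.
Qed.

Lemma bmfN u : bounded_measurable u -> bounded_measurable (fun x => - u x).
Proof.
move=> [mu [M uM]]; split; first exact: measurableT_comp.
by exists M => x; rewrite normrN.
Qed.

Lemma bmfB u v : bounded_measurable u -> bounded_measurable v ->
  bounded_measurable (fun x => u x - v x).
Proof. by move=> bu bv; apply: bmfD => //; exact: bmfN. Qed.

Lemma bmfM u v : bounded_measurable u -> bounded_measurable v ->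
  bounded_measurable (fun x => u x * v x).
Proof.
move=> [mu [M uM]] [mv [N vN]]; split; first exact: measurable_funM.
by exists (M * N) => x; rewrite normrM; exact: ler_pM.
Qed.

Lemma bmf_indic (A : set X) : measurable A -> bounded_measurable \1_A.
Proof.
move=> mA; split; first exact: measurable_indic.
by exists 1 => x; rewrite ger0_norm// indicE lern1 leq_b1.
Qed.

Lemma bmf_sum (I : Type) (s : seq I) (F : I -> X -> R) :
  (forall i, bounded_measurable (F i)) ->
  bounded_measurable (fun x => \sum_(i <- s) F i x).
Proof.
move=> bF; elim: s => [|i s IH].
  by under eq_fun do rewrite big_nil; exact: bmf_cst.
by under eq_fun do rewrite big_cons; exact: bmfD.
Qed.

Lemma bmf_cos u : measurable_fun setT u -> bounded_measurable (fun x => cos (u x)).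
Proof.
move=> mu; split; last by exists 1 => x; exact: cos_max.
by apply: measurableT_comp => //; apply: continuous_measurable_fun; exact: continuous_cos.
Qed.

Lemma bmf_sin u : measurable_fun setT u -> bounded_measurable (fun x => sin (u x)).
Proof.
move=> mu; split; last by exists 1 => x; exact: sin_max.
by apply: measurableT_comp => //; apply: continuous_measurable_fun; exact: continuous_sin.
Qed.

Lemma bmf_integrable (A : set X) u : bounded_measurable u -> measurable A ->
  m.-integrable A (EFin \o u).
Proof.
move=> [mu [M uM]] mA; apply: measurable_bounded_integrable => //.
- by rewrite (le_lt_trans (probability_le1 _ _))// ltry.
- exact: measurable_funTS.
- by exists M; split; rewrite ?num_real// => N MN x _; exact: le_trans (ltW MN).
Qed.

Lemma bmf_EFin u : bounded_measurable u ->
  (\int[m]_x (u x)%:E)%E = (\int[m]_x u x)%:E.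
Proof.
move=> bu; rewrite fineK//.
by have := bmf_integrable bu measurableT; move/integrable_fin_num; apply.
Qed.

Lemma RintegralD_bmf u v : bounded_measurable u -> bounded_measurable v ->
  \int[m]_x (u x + v x) = \int[m]_x u x + \int[m]_x v x.
Proof. by move=> bu bv; rewrite RintegralD//; exact: bmf_integrable. Qed.

Lemma RintegralB_bmf u v : bounded_measurable u -> bounded_measurable v ->
  \int[m]_x (u x - v x) = \int[m]_x u x - \int[m]_x v x.
Proof. by move=> bu bv; rewrite RintegralB//; exact: bmf_integrable. Qed.

Lemma RintegralZ_bmf r u : bounded_measurable u ->
  \int[m]_x (r * u x) = r * \int[m]_x u x.
Proof. by move=> bu; rewrite RintegralZl//; exact: bmf_integrable. Qed.

Lemma Rintegral_sum_bmf (I : Type) (s : seq I) (F : I -> X -> R) :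
  (forall i, bounded_measurable (F i)) ->
  \int[m]_x (\sum_(i <- s) F i x) = \sum_(i <- s) \int[m]_x F i x.
Proof.
move=> bF; elim: s => [|i s IH].
  rewrite big_nil; under eq_Rintegral do rewrite big_nil.
  by rewrite Rintegral_cst// mul0r.
rewrite big_cons; under eq_Rintegral do rewrite big_cons.
by rewrite RintegralD_bmf ?IH//; exact: bmf_sum.
Qed.

Lemma le_Rintegral_bmf u v : bounded_measurable u -> bounded_measurable v ->
  (forall x, u x <= v x) -> \int[m]_x u x <= \int[m]_x v x.
Proof. by move=> bu bv uv; apply: le_Rintegral => //; exact: bmf_integrable. Qed.

Lemma Rintegral_cst_prob r : \int[m]_(x in setT) (fun=> r) x = r.
Proof.
rewrite Rintegral_cst// -[RHS]mulr1; congr (_ * _).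
exact: (congr1 fine (probability_setT m)).
Qed.

Lemma Rintegral_abs_le u M : bounded_measurable u -> (forall x, `|u x| <= M) ->
  `|\int[m]_x u x| <= M.
Proof.
move=> bu uM; rewrite ler_norml -{1}(Rintegral_cst_prob (- M)) -{2}(Rintegral_cst_prob M).
by apply/andP; split; apply: le_Rintegral_bmf => //; try exact: bmf_cst;
  move=> x; have := uM x; rewrite ler_norml => /andP[].
Qed.

Lemma Rintegral_indic (A : set X) : measurable A ->
  \int[m]_x \1_A x = fine (m A).
Proof. by move=> mA; rewrite /Rintegral integral_indic// setIT. Qed.

Lemma ae_eq_Rintegral u v : bounded_measurable u -> bounded_measurable v ->
  {ae m, forall x, u x = v x} -> \int[m]_x u x = \int[m]_x v x.
Proof.
move=> [mu _] [mv _] uv; congr fine; apply: ae_eq_integral => //.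
- exact/measurable_EFinP.
- exact/measurable_EFinP.
by apply: filterS uv => x /= ->.
Qed.

Lemma Rintegral_eq0_ae u : bounded_measurable u -> (forall x, 0 <= u x) ->
  \int[m]_x u x = 0 -> {ae m, forall x, u x = 0}.
Proof.
move=> bu u0 iu0.
have /(ae_eq_integral_abs m measurableT) [+ _] : measurable_fun setT (EFin \o u).
  by apply/measurable_EFinP; case: bu.
have -> : (\int[m]_x `|(EFin \o u) x|)%E = 0%E.
  rewrite -[RHS]/(0%:E) -iu0 -bmf_EFin//; apply: eq_integral => x _ /=.
  by rewrite ger0_norm.
by move=> /(_ erefl); apply: filterS => x /= /(_ I) [].
Qed.

End bounded_measurable.

Lemma Rintegral_mp (R : realType) (d d' : measure_display)
    (X : measurableType d) (Y : measurableType d')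
    (m : probability X R) (mu : probability Y R) (h : X -> Y) (u : Y -> R) :
  measure_preserving m mu h -> bounded_measurable u ->
  bounded_measurable (u \o h) /\ \int[m]_x u (h x) = \int[mu]_y u y.
Proof.
move=> hP bu; have [mu' [M uM]] := bu.
have buh : bounded_measurable (u \o h).
  by split; [apply: measurableT_comp => //; case: hP|exists M => x; exact: uM].
(* adding the bound [M] makes both integrands nonnegative *)
split=> //; have bM := bmf_cst X M; have bM' := bmf_cst Y M.
apply: (@addIr _ M).
rewrite -{1}(Rintegral_cst_prob m M) -{2}(Rintegral_cst_prob mu M).
rewrite -!RintegralD_bmf//; congr fine.
apply: (mp_ge0_integral hP (u := fun y => (u y + M)%:E)).
  by apply/measurable_EFinP; exact: measurable_funD.
by move=> y; rewrite lee_fin; have := uM y; rewrite ler_norml => /andP[]; lra.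
Qed.

(** * Conditional expectations *)

Lemma ae_le1_of_integral_le (R : realType) (d : measure_display)
    (X : measurableType d) (m : probability X R) (h : X -> R) :
  measurable_fun setT h ->
  (forall A, measurable A -> (\int[m]_(x in A) (h x)%:E <= m A)%E) ->
  {ae m, forall x, h x <= 1}.
Proof.
move=> mh hle; pose A n := [set x | 1 + n.+1%:R^-1 < h x].
have mA n : measurable (A n) by apply: measurable_ltr_set => //; exact: measurable_cst.
have mhE B : measurable_fun B (EFin \o h) by apply/measurable_EFinP; exact: measurable_funTS.
have A0 n : m (A n) = 0%E.
  have := hle _ (mA n); have fin := fin_num_measure m _ (mA n).
  have e0 : 0 < n.+1%:R^-1 :> R by rewrite invr_gt0.
  have : ((1 + n.+1%:R^-1)%:E * m (A n) <= \int[m]_(x in A n) (h x)%:E)%E.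
    rewrite -integral_cst//; apply: ge0_le_integral => //.
    - by move=> x _; rewrite lee_fin addr_ge0// ltW.
    - by move=> x /= hx; rewrite lee_fin; exact: ltW.
  move=> /le_trans /[apply]; rewrite -(fineK fin) -EFinM lee_fin mulrDl mul1r gerDl => le1.
  congr EFin; apply/eqP; rewrite eq_le fine_ge0//= andbT.
  by rewrite -(pmulr_rle0 _ e0).
have mU : measurable (\bigcup_n A n) by exact: bigcupT_measurable.
exists (\bigcup_n A n); split => //.
  apply/(negligibleP m mU).
  by apply: negligible_bigcup => n; apply/(negligibleP m (mA n)); exact: A0.
move=> x /= /negP; rewrite -ltNge => h1.
have h0 : 0 < h x - 1 by lra.
exists (Num.truncn (h x - 1)^-1) => //; rewrite /A /=.
have := truncnS_gt (h x - 1)^-1; set k := _.+1 => hk.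
rewrite -ltrBrDl -[ltRHS]invrK ltf_pV2// ?posrE ?invr_gt0//.
Qed.

Section bounded_test_functions.
Context (R : realType) (d d' : measure_display).
Context (X' : measurableType d') (X : measurableType d).
Context (m' : probability X' R) (m : probability X R) (pi : X' -> X).
Hypothesis hpi : measure_preserving m' m pi.
Context (c : X' -> R) (C : X -> R).
Hypothesis bc : bounded_measurable c.
Hypothesis bC : bounded_measurable C.
Hypothesis cC : forall B, measurable B ->
  \int[m']_x (\1_B (pi x) * c x) = \int[m]_x (\1_B x * C x).

Let defect (u : X -> R) :=
  \int[m']_x (u (pi x) * c x) - \int[m]_x (u x * C x).

Let bcomp (u : X -> R) : bounded_measurable u -> bounded_measurable (u \o pi).
Proof. by move=> bu; exact: (Rintegral_mp hpi bu).1. Qed.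

Let defect_le u M : bounded_measurable u -> (forall x, `|u x| <= M) ->
  forall K L, (forall x, `|c x| <= K) -> (forall x, `|C x| <= L) ->
  `|defect u| <= M * (K + L).
Proof.
move=> bu uM K L cK CL; rewrite /defect (le_trans (ler_normB _ _))// mulrDr.
apply: lerD; apply: Rintegral_abs_le.
- by apply: bmfM => //; exact: bcomp.
- by move=> x; rewrite normrM; apply: ler_pM.
- exact: bmfM.
- by move=> x; rewrite normrM; apply: ler_pM.
Qed.

Let defectB u v : bounded_measurable u -> bounded_measurable v ->
  defect (fun x => u x - v x) = defect u - defect v.
Proof.
move=> bu bv; rewrite /defect.
under eq_Rintegral do rewrite mulrBl.
under [X in _ - X = _]eq_Rintegral do rewrite mulrBl.
have bu' := bmfM (bcomp bu) bc; have bv' := bmfM (bcomp bv) bc.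
rewrite (RintegralB_bmf _ bu' bv') (RintegralB_bmf _ (bmfM bu bC) (bmfM bv bC)).
by rewrite /=; ring.
Qed.

Let defect_simple n (A : nat -> set X) (r : nat -> R) : (forall i, measurable (A i)) ->
  defect (fun x => \sum_(0 <= i < n) r i * \1_(A i) x) = 0.
Proof.
move=> mA; rewrite /defect.
under eq_Rintegral do rewrite mulr_suml.
under [X in _ - X = _]eq_Rintegral do rewrite mulr_suml.
have bA i := bmf_indic R (mA i).
have b1 i : bounded_measurable (fun x => r i * \1_(A i) x * C x).
  by apply: bmfM => //; apply: bmfM => //; exact: bmf_cst.
have b2 i : bounded_measurable (fun x => r i * \1_(A i) (pi x) * c x).
  by apply: bmfM => //; apply: bmfM; [exact: bmf_cst|exact: bcomp].
rewrite !Rintegral_sum_bmf// -sumrB big1_seq// => i _.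
under eq_Rintegral do rewrite -mulrA.
under [X in _ - X = _]eq_Rintegral do rewrite -mulrA.
rewrite !RintegralZ_bmf; [|exact: bmfM|].
  by rewrite cC// subrr.
by apply: bmfM => //; exact: bcomp.
Qed.

(** From indicators the identity extends by linearity to step functions, and
    these approximate [u] uniformly, while both sides are continuous in [u] for
    the uniform norm. *)
Lemma eq_Rintegral_of_indic u : bounded_measurable u ->
  \int[m']_x (u (pi x) * c x) = \int[m]_x (u x * C x).
Proof.
move=> bu; apply/eqP; rewrite -subr_eq0 -/(defect u) -normr_eq0.
have [mu [M uM]] := bu; have [_ [K cK]] := bc; have [_ [L CL]] := bC.
apply/negPn/negP => D0; have {}D0 : 0 < `|defect u| by rewrite lt_def D0 normr_ge0.
(* a step function within [1 / n] of [u] has defect 0, so the defect of [u] is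
   at most [(K + L) / n]; this [n] is large enough for a contradiction *)
pose n := (Num.truncn ((K + L) / `|defect u|)).+1.
have n0 : 0 < n%:R :> R by [].
pose N := (Num.truncn (2 * M * n%:R)).+1.
pose w x := (u x + M) * n%:R.
have mw : measurable_fun setT w.
  by apply: measurable_funM => //; exact: measurable_funD.
have w0 x : 0 <= w x.
  apply: mulr_ge0 => //; by have := uM x; rewrite ler_norml => /andP[]; lra.
pose A i := [set x | i%:R <= w x < i.+1%:R].
have mA i : measurable (A i).
  rewrite (_ : A i = [set x | w x < i.+1%:R] `\` [set x | w x < i%:R]); last first.
    apply/seteqP; split => x; rewrite /A /=.
      by move=> /andP[h1 h2]; split => //; apply/negP; rewrite -leNgt.
    by move=> [h2 /negP]; rewrite -leNgt => h1; apply/andP.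
  by apply: measurableD; apply: measurable_ltr_set => //; exact: measurable_cst.
pose v x := \sum_(0 <= i < N) (i%:R / n%:R - M) * \1_(A i) x.
have vE x : v x = (Num.truncn (w x))%:R / n%:R - M.
  have kN : (Num.truncn (w x) < N)%N.
    rewrite /N ltnS; apply: le_truncn; rewrite ler_pM2r//.
    by have := uM x; rewrite ler_norml => /andP[]; lra.
  have A1 : \1_(A (Num.truncn (w x))) x = 1 :> R.
    by rewrite indicE mem_set// /A /= truncn_itv.
  rewrite /v big_mkord (bigD1 (Ordinal kN))//= A1 mulr1 big1 ?addr0// => i ik.
  rewrite indicE memNset ?mulr0// /A /= => /truncn_def E.
  by move/eqP: ik; apply; apply/val_inj; rewrite /= E.
have bv : bounded_measurable v.
  apply: bmf_sum => i; apply: bmfM; first exact: bmf_cst.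
  exact: bmf_indic.
have uv x : `|u x - v x| <= n%:R^-1.
  rewrite vE; have /andP[h1 h2] := truncn_itv (w0 x).
  have -> : u x - ((Num.truncn (w x))%:R / n%:R - M) = (w x - (Num.truncn (w x))%:R) / n%:R.
    by rewrite /w; field; rewrite gt_eqF.
  rewrite normrM [X in _ * X]ger0_norm ?invr_ge0// ler_piMl ?invr_ge0// ger0_norm; last lra.
  by rewrite -natr1 in h2; lra.
have := defect_le (bmfB bu bv) uv cK CL.
rewrite defectB// /v defect_simple// subr0 => le1.
have := truncnS_gt ((K + L) / `|defect u|); rewrite -/n ltr_pdivrMr// => lt1.
by move: le1; rewrite mulrC ler_pdivlMr// mulrC leNgt lt1.
Qed.

End bounded_test_functions.

(** [C] is the Radon-Nikodym density of the image under [pi] of the charge with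
    density [c].  This image is dominated by [m], so the density lies between
    -1 and 1 almost everywhere, and truncation makes it bounded. *)
Lemma conditional_expectation_exists (R : realType) (d d' : measure_display)
    (X' : measurableType d') (X : measurableType d)
    (m' : probability X' R) (m : probability X R) (pi : X' -> X) (c : X' -> R) :
  measure_preserving m' m pi ->
  measurable_fun setT c -> (forall x, `|c x| <= 1) ->
  exists C : X -> R, bounded_measurable C /\
    forall u, bounded_measurable u ->
      \int[m']_x (u (pi x) * c x) = \int[m]_x (u x * C x).
Proof.
move=> hpi mc c1; have mpi := hpi.1.
have bc : bounded_measurable c by split => //; exists 1.
have ic : m'.-integrable setT (EFin \o c) by exact: bmf_integrable.
pose nu0 := charge_induced_charge__canonical__charge_Charge ic.
pose nu := measure_function_pushforward__canonical__charge_Charge nu0 mpi.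
have nuE B : nu B = (\int[m']_(x in pi @^-1` B) (c x)%:E)%E by [].
have nule B : measurable B -> (`|nu B| <= m B)%E.
  move=> mB; have mpB : measurable (pi @^-1` B).
    exact: (mp_measurable hpi mB).
  rewrite nuE -hpi.2//; apply: le_trans (le_abse_integral _ _ _) _ => //.
    by apply/measurable_EFinP; exact: measurable_funTS.
  rewrite -[leRHS]mul1e -integral_cst//; apply: ge0_le_integral => //.
  - by apply: measurableT_comp => //; apply/measurable_EFinP; exact: measurable_funTS.
  - by move=> x _; rewrite lee_fin.
have num : nu `<< m.
  apply/null_content_dominatesP => B mB mB0.
  by apply/eqP; rewrite -abse_eq0 eq_le abse_ge0 andbT -mB0; exact: nule.
pose h x := fine (Radon_Nikodym nu m x).
have hE x : (h x)%:E = Radon_Nikodym nu m x by rewrite fineK// Radon_Nikodym_fin_num.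
have ih : m.-integrable setT (EFin \o h).
  by rewrite (_ : _ \o _ = Radon_Nikodym nu m); [exact: Radon_Nikodym_integrable|apply/funext].
have mh : measurable_fun setT h by apply/measurable_EFinP; exact: measurable_int ih.
have hnu B : measurable B -> (\int[m]_(x in B) (h x)%:E = nu B)%E.
  by move=> mB; rewrite (Radon_Nikodym_integral num mB); apply: eq_integral => x _.
have h1 : {ae m, forall x, h x <= 1}.
  apply: ae_le1_of_integral_le => // B mB; rewrite hnu//.
  exact: le_trans (lee_abs _) (nule _ mB).
have h2 : {ae m, forall x, - h x <= 1}.
  apply: ae_le1_of_integral_le; first exact: measurableT_comp.
  move=> B mB; under eq_integral do rewrite EFinN.
  have ihB : m.-integrable B (EFin \o h) by exact: (integrableS measurableT mB).
  rewrite integralN; last exact: integrable_add_def ihB.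
  rewrite hnu//; apply: le_trans (nule _ mB).
  by rewrite -abseN; exact: lee_abs.
pose C x := Num.max (-1) (Num.min (h x) 1).
have bC : bounded_measurable C.
  split; first by apply: measurable_maxr => //; exact: measurable_minr.
  exists 1 => x; rewrite ler_norml /C le_max lexx /= ge_max.
  by rewrite ge_min lexx orbT andbT; lra.
have CE : {ae m, forall x, C x = h x}.
  apply: filterS2 h1 h2 => x hx1 hx2.
  by rewrite /C (min_idPl hx1); apply/max_idPr; lra.
exists C; split=> // u bu; apply: eq_Rintegral_of_indic => // B mB.
have mpB : measurable (pi @^-1` B) by exact: (mp_measurable hpi mB).
have iE (d0 : measure_display) (Z : measurableType d0) (z : probability Z R) (A : set Z) (k : Z -> R) :
    measurable A -> bounded_measurable k ->
    ((\int[z]_x (\1_A x * k x))%:E = \int[z]_(x in A) (k x)%:E)%E.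
  move=> mA bk; rewrite -bmf_EFin; last by apply: bmfM => //; exact: bmf_indic.
  rewrite [RHS]integral_mkcond; apply: eq_integral => x _.
  rewrite patchE indicE; case: ifP => _; first by rewrite mul1r.
  by rewrite mul0r.
apply: EFin_inj; rewrite -[LHS]/((\int[m']_x (\1_(pi @^-1` B) x * c x))%:E).
rewrite !iE// -nuE -hnu//; apply: ae_eq_integral => //.
- by apply/measurable_EFinP; exact: measurable_funTS.
- by apply/measurable_EFinP; apply: measurable_funTS; case: bC.
by apply: filterS CE => x /= ->.
Qed.

(** * Equivariance of conditional expectations *)

Section equivariance.
Context (R : realType) (d d' : measure_display).
Context (X' : measurableType d') (X : measurableType d).
Context (m' : probability X' R) (m : probability X R).
Context (T' : X' -> X') (T : X -> X) (pi : X' -> X).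
Hypothesis hT' : measure_preserving m' m' T'.
Hypothesis hT : measure_preserving m m T.
Hypothesis hpi : measure_preserving m' m pi.
Hypothesis hcomm : T \o pi = pi \o T'.
Context (c s : X' -> R) (b : X -> R) (C S : X -> R).
Hypotheses (bc : bounded_measurable c) (bs : bounded_measurable s).
Hypothesis mb : measurable_fun setT b.
Hypothesis cT : {ae m', forall x,
  c (T' x) = c x * cos (b (pi x)) + s x * sin (b (pi x))}.
Hypothesis sT : {ae m', forall x,
  s (T' x) = s x * cos (b (pi x)) - c x * sin (b (pi x))}.
Hypotheses (bC : bounded_measurable C) (bS : bounded_measurable S).
Hypothesis cC : forall u, bounded_measurable u ->
  \int[m']_x (u (pi x) * c x) = \int[m]_x (u x * C x).
Hypothesis sS : forall u, bounded_measurable u ->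
  \int[m']_x (u (pi x) * s x) = \int[m]_x (u x * S x).

(** Write [e = c + i s] and [E = C + i S].  The hypotheses say that [e \o T'] is
    [e exp (- i b)], with [b] read on [X'], and the claim is that the difference
    of [E \o T] and [E exp (- i b)] vanishes.  The integral of its squared
    modulus is twice that of [|E|^2] minus twice a cross term.  In the cross term
    [E] may be replaced by [e], on which the equation is known; as [T'] preserves
    [m'], the cross term is then the integral of [|E|^2] as well. *)
Lemma conditional_expectation_equivariant : {ae m, forall x,
  C (T x) = C x * cos (b x) + S x * sin (b x) /\
  S (T x) = S x * cos (b x) - C x * sin (b x)}.
Proof.
have bco : bounded_measurable (fun x => cos (b x)) by exact: bmf_cos.
have bsi : bounded_measurable (fun x => sin (b x)) by exact: bmf_sin.
have bCT : bounded_measurable (fun x => C (T x)) := (Rintegral_mp hT bC).1.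
have bST : bounded_measurable (fun x => S (T x)) := (Rintegral_mp hT bS).1.
have bpi u (bu : bounded_measurable u) : bounded_measurable (fun x => u (pi x)) :=
  (Rintegral_mp hpi bu).1.
have bT' u (bu : bounded_measurable u) : bounded_measurable (fun x => u (T' x)) :=
  (Rintegral_mp hT' bu).1.
pose N x := C x * C x + S x * S x.
have bN : bounded_measurable N by apply: bmfD; exact: bmfM.
have bNT : bounded_measurable (fun x => N (T x)) := (Rintegral_mp hT bN).1.
pose C1 x := C x * cos (b x) + S x * sin (b x).
pose S1 x := S x * cos (b x) - C x * sin (b x).
have bC1 : bounded_measurable C1 by apply: bmfD; exact: bmfM.
have bS1 : bounded_measurable S1 by apply: bmfB; exact: bmfM.
(* [u1] and [u2] collect the factors of [C] and [S] in the cross term *)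
pose u1 x := C (T x) * cos (b x) - S (T x) * sin (b x).
pose u2 x := C (T x) * sin (b x) + S (T x) * cos (b x).
have bu1 : bounded_measurable u1 by apply: bmfB; exact: bmfM.
have bu2 : bounded_measurable u2 by apply: bmfD; exact: bmfM.
have cross : \int[m]_x (u1 x * C x + u2 x * S x) = \int[m]_x N x.
  rewrite RintegralD_bmf; [|exact: bmfM..].
  rewrite -cC// -sS// -RintegralD_bmf; [|by apply: bmfM => //; exact: bpi..].
  have bCc : bounded_measurable (fun x => C (pi x) * c x + S (pi x) * s x).
    by apply: bmfD; apply: bmfM => //; exact: bpi.
  transitivity (\int[m']_x (C (pi (T' x)) * c (T' x) + S (pi (T' x)) * s (T' x))).
    apply: ae_eq_Rintegral.
    - by apply: bmfD; apply: bmfM => //; exact: bpi.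
    - by apply: (bT' _ bCc).
    apply: filterS2 cT sT => x -> ->.
    have -> : pi (T' x) = T (pi x) by rewrite -[RHS]/((T \o pi) x) hcomm.
    by rewrite /u1 /u2; ring.
  rewrite (Rintegral_mp hT' bCc).2 /N.
  rewrite RintegralD_bmf; [|by apply: bmfM => //; exact: bpi..].
  by rewrite cC// sS// -RintegralD_bmf//; exact: bmfM.
have Z0 : {ae m, forall x, (C (T x) - C1 x) ^+ 2 + (S (T x) - S1 x) ^+ 2 = 0}.
  apply: Rintegral_eq0_ae.
  - have bd1 := bmfB bCT bC1; have bd2 := bmfB bST bS1.
    by apply: bmfD; under eq_fun do rewrite expr2; exact: bmfM.
  - by move=> x; rewrite addr_ge0// sqr_ge0.
  transitivity (\int[m]_x (N (T x) + N x - 2 * (u1 x * C x + u2 x * S x))).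
    apply: eq_Rintegral => x _; rewrite /N /u1 /u2 /C1 /S1.
    by have := cos2Dsin2 (b x); set co := cos _; set si := sin _ => h; nra.
  have bu : bounded_measurable (fun x => u1 x * C x + u2 x * S x).
    by apply: bmfD; exact: bmfM.
  rewrite RintegralB_bmf; [|exact: bmfD|by apply: bmfM => //; exact: bmf_cst].
  rewrite RintegralD_bmf// RintegralZ_bmf// cross (Rintegral_mp hT bN).2; ring.
apply: filterS Z0 => x /eqP; rewrite paddr_eq0 ?sqr_ge0// !sqrf_eq0 !subr_eq0.
by move=> /andP[/eqP -> /eqP ->].
Qed.

End equivariance.

(** The half-angle formula [tan (t / 2) = y / (1 + x)] makes the angle a
    measurable function of the point on the circle. *)
Lemma angle_exists (R : realType) (x y : R) : x ^+ 2 + y ^+ 2 = 1 ->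
  let t := if x == -1 then pi else 2 * atan (y / (1 + x)) in
  cos t = x /\ sin t = y.
Proof.
move=> xy /=; case: eqP => [x1|/eqP x1].
  rewrite cospi sinpi x1; split => //; move: xy; rewrite x1 sqrrN expr1n => h.
  by apply/esym/eqP; rewrite -sqrf_eq0; apply/eqP; lra.
have x1' : 1 + x != 0 by rewrite addrC addr_eq0.
set a := atan _; have ca : cos a != 0 by rewrite cos_atan gt_eqF// invr_gt0 sqrtr_gt0; have := sqr_ge0 (y / (1 + x)); lra.
have ta : sin a = y / (1 + x) * cos a.
  by rewrite -[y / _]atanK -/a /tan mulfVK.
have h2 := cos2Dsin2 a.
have c2 : cos a ^+ 2 = (1 + x) / 2.
  move: h2; rewrite ta exprMn => h2.
  have : cos a ^+ 2 * (2 / (1 + x)) = 1.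
    have y2 : y ^+ 2 = (1 - x) * (1 + x) by lra.
    rewrite -[RHS]h2 expr_div_n y2; by field.
  move=> h; apply: (mulIf (x := 2 / (1 + x))).
    by rewrite mulf_neq0// invr_neq0.
  by rewrite h; field.
rewrite mulrDl !mul1r cosD sinD; split.
  by move: h2; rewrite -!expr2 => h2; lra.
rewrite ta; transitivity (2 * (y / (1 + x)) * cos a ^+ 2); first by ring.
by rewrite c2; field.
Qed.

(** * From an equivariant function to periodicity *)

Lemma measurable_invr (R : realType) : measurable_fun setT (@GRing.inv R).
Proof.
rewrite -(setUv [set (0 : R)]); apply/measurable_funU => //.
  exact: measurableC.
split; first exact: measurable_fun_set1.
apply: open_continuous_measurable_fun.
  rewrite (_ : [set~ 0] = [set x | x != 0]); first exact: open_neq.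
  by apply/seteqP; split => x /eqP.
by move=> x /set_mem /eqP; exact: inv_continuous.
Qed.

Lemma cosDint (R : realType) (x : R) (k : int) : cos (x + pi *+ 2 * k%:~R) = cos x.
Proof.
case: k => n.
  by rewrite -pmulrn mulr_natr (periodicn (@cosD2pi R)).
rewrite NegzE mulrNz -pmulrn mulrN mulr_natr -[LHS](periodicn (@cosD2pi R) n.+1).
by rewrite subrK.
Qed.

Lemma sinDint (R : realType) (x : R) (k : int) : sin (x + pi *+ 2 * k%:~R) = sin x.
Proof.
case: k => n.
  by rewrite -pmulrn mulr_natr (periodicn (@sinD2pi R)).
rewrite NegzE mulrNz -pmulrn mulrN mulr_natr -[LHS](periodicn (@sinD2pi R) n.+1).
by rewrite subrK.
Qed.

Lemma angle_unique (R : realType) (u v : R) : cos u = cos v -> sin u = sin v ->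
  u = v + pi *+ 2 * (Num.floor ((u - v) / (pi *+ 2)))%:~R.
Proof.
move=> cuv suv; set k := Num.floor _.
have p0 : 0 < pi *+ 2 :> R by rewrite pmulrn_lgt0// pi_gt0.
pose w := u - v - pi *+ 2 * k%:~R.
have /andP[kl kr] := floor_itv ((u - v) / (pi *+ 2)).
have w0 : 0 <= w by rewrite /w subr_ge0 mulrC -ler_pdivlMr.
have w2 : w < pi *+ 2.
  by move: kr; rewrite ltr_pdivrMr// intrD mulrDl mul1r /w -/k; lra.
have cw : cos w = 1.
  rewrite /w -mulrN -mulrNz cosDint cosB cuv suv -!expr2.
  exact: cos2Dsin2.
have w00 : w = 0.
  apply/eqP; rewrite eq_le w0 andbT leNgt; apply/negP => wp.
  have : 0 < sin (w / 2).
    by apply: sin_gt0_pi; rewrite divr_gt0//= ltr_pdivrMr// mulr_natr.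
  have := cos2Dsin2 (w / 2); have := cosD (w / 2) (w / 2).
  rewrite -splitr cw => h1 h2 h3; have : sin (w / 2) ^+ 2 = 0 by nra.
  by move/eqP; rewrite sqrf_eq0 gt_eqF.
by move: w00; rewrite /w => /eqP; rewrite subr_eq0 => /eqP /(canRL (subrK _)); rewrite addrC.
Qed.

Lemma measurable_floor_preimage (R : realType) (d : measure_display)
    (X : measurableType d) (w : X -> R) (B : set int) :
  measurable_fun setT w -> measurable ((fun x => Num.floor (w x)) @^-1` B).
Proof.
move=> mw; have mk (k : int) : measurable [set x | Num.floor (w x) = k].
  rewrite (_ : [set x | _] = [set x | w x < (k + 1)%:~R] `\` [set x | w x < k%:~R]).
    by apply: measurableD; apply: measurable_ltr_set => //; exact: measurable_cst.
  apply/seteqP; split => x /=.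
    by move=> <-; have /andP[h1 h2] := floor_itv (w x); split=> //; apply/negP; rewrite -leNgt.
  by move=> [h1 /negP]; rewrite -leNgt => h2; apply: floor_def; rewrite h2.
rewrite (_ : _ @^-1` _ =
    (\bigcup_(n in [set n | B (Posz n)]) [set x | Num.floor (w x) = Posz n]) `|`
    (\bigcup_(n in [set n | B (Negz n)]) [set x | Num.floor (w x) = Negz n])).
  by apply: measurableU; apply: bigcup_measurable => n _; exact: mk.
apply/seteqP; split => x /=.
  by case E : (Num.floor (w x)) => [n|n] Bn; [left|right]; exists n.
by move=> [] [n /= Bn ->].
Qed.

(** The modulus of [C + i S] is constant along orbits.  Dividing by it gives a point
    of the circle which [T] rotates by [- a (f - rho)], so its angle divided by
    [a] is a transfer function for [f - rho], up to multiples of [2 pi / a]. *)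
Lemma periodic_of_equivariant (R : realType) (d : measure_display)
    (X : measurableType d) (m : probability X R) (T : X -> X)
    (f : X -> R) (rho a : R) (C S : X -> R) :
  measurable_fun setT T -> measurable_fun setT f -> 0 < a ->
  measurable_fun setT C -> measurable_fun setT S ->
  {ae m, forall x,
    C (T x) = C x * cos (a * (f x - rho)) + S x * sin (a * (f x - rho)) /\
    S (T x) = S x * cos (a * (f x - rho)) - C x * sin (a * (f x - rho))} ->
  {ae m, forall x, 0 < C x ^+ 2 + S x ^+ 2} ->
  periodic_for m T f.
Proof.
move=> mT mf a0 mC mS eq pos.
pose N x := C x ^+ 2 + S x ^+ 2.
pose r x := Num.sqrt (N x).
have mN : measurable_fun setT N by apply: measurable_funD; exact: measurable_funX.
have mr : measurable_fun setT r.
  by apply: (measurableT_comp _ mN); apply: continuous_measurable_fun; exact: sqrt_continuous.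
have mri : measurable_fun setT (fun x => (r x)^-1) by exact: (measurableT_comp (@measurable_invr R)).
pose cx x := C x / r x; pose sx x := S x / r x.
have mcx : measurable_fun setT cx by exact: measurable_funM.
have msx : measurable_fun setT sx by exact: measurable_funM.
pose th x := if cx x == -1 then pi else 2 * atan (sx x / (1 + cx x)).
have mth : measurable_fun setT th.
  apply: measurable_fun_ifT => //.
    by apply: measurable_fun_eqr => //; exact: measurable_cst.
  apply: measurable_funM => //; apply: measurableT_comp.
    by apply: continuous_measurable_fun; exact: continuous_atan.
  apply: measurable_funM => //; apply: (measurableT_comp (@measurable_invr R)).
  exact: measurable_funD.
have thE x : 0 < N x -> cos (th x) = cx x /\ sin (th x) = sx x.
  move=> Nx; apply: angle_exists.
  by rewrite !expr_div_n sqr_sqrtr ?ltW// -mulrDl divff// gt_eqF.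
pose b x := a * (f x - rho).
have mb : measurable_fun setT b.
  by apply: measurable_funM => //; exact: measurable_funB.
pose w x := (th (T x) - (th x - b x)) / (pi *+ 2).
have mw : measurable_fun setT w.
  apply: measurable_funM => //; apply: measurable_funB.
    exact: measurableT_comp.
  exact: measurable_funB.
have p0 : 0 < pi *+ 2 :> R by rewrite pmulrn_lgt0// pi_gt0.
exists rho, (fun x => th x / a), (pi *+ 2 / a), (fun x => Num.floor (w x)); split.
- exact: measurable_funM.
- exact: divr_gt0.
- by move=> B; exact: measurable_floor_preimage.
apply: filterS2 eq pos => x [eC eS] px.
have NT : N (T x) = N x.
  have := cos2Dsin2 (b x); rewrite /N eC eS -/(b x).
  by set co := cos _; set si := sin _ => h; nra.
have [c1 s1] := thE _ px.
have [c2 s2] := thE (T x) (etrans (congr1 _ NT) px).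
have c3 : cos (th (T x)) = cos (th x - b x).
  by rewrite c2 cosB c1 s1 /cx /sx /r NT eC -/(b x); ring.
have s3 : sin (th (T x)) = sin (th x - b x).
  by rewrite s2 sinB c1 s1 /cx /sx /r NT eS -/(b x); ring.
have := angle_unique c3 s3; rewrite -/(w x) /b => h.
rewrite h; field; exact: lt0r_neq0.
Qed.

(** * Vanishing Fourier coefficients give almost uniform fibres *)

Lemma cos_ge_half (R : realType) (z : R) : `|z| <= pi / 4 -> 1 / 2 <= cos z.
Proof.
rewrite ler_norml => /andP[z1 z2]; have p0 := pi_gt0 R.
have c0 : 0 <= cos z.
  by apply: cos_ge0_pihalf; apply/andP; split; lra.
have c1 := cos_le1 z.
have : 0 <= cos (z + z) by apply: cos_ge0_pihalf; apply/andP; split; lra.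
by rewrite cosD -!expr2 => h; have := cos2Dsin2 z; nra.
Qed.

Section fejer_kernel.
Context (R : realType).

(** The squared modulus of the sum of [exp (i k y)] over [k < L], that is, [L]
    times the Fejer kernel. *)
Definition fejer (L : nat) (y : R) : R :=
  (\sum_(i < L) cos (i%:R * y)) ^+ 2 + (\sum_(i < L) sin (i%:R * y)) ^+ 2.

Lemma fejerE L y : fejer L y = \sum_(i < L) \sum_(j < L) cos ((i%:R - j%:R) * y).
Proof.
rewrite /fejer !expr2 !big_distrlr -big_split; apply: eq_bigr => i _ /=.
by rewrite -big_split; apply: eq_bigr => j _; rewrite /= mulrBl cosB.
Qed.

(** On this arc every term of the sum of cosines is at least 1/2. *)
Lemma fejer_ge L y : L%:R * `|y| <= pi / 4 -> (L%:R / 2) ^+ 2 <= fejer L y.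
Proof.
move=> Ly; have y0 := normr_ge0 y; have L0 := ler0n R L.
have half (i : 'I_L) : 1 / 2 <= cos (i%:R * y).
  apply: cos_ge_half; rewrite normrM normr_nat (le_trans _ Ly)// ler_wpM2r//.
  by rewrite ler_nat ltnW.
have hs : L%:R / 2 <= \sum_(i < L) cos (i%:R * y).
  rewrite -[L in leLHS]card_ord -sumr_const mulr_suml; exact: ler_sum.
by rewrite /fejer -[leLHS]addr0 lerD ?sqr_ge0// lerXn2r ?nnegrE ?divr_ge0// (le_trans _ hs)// divr_ge0.
Qed.

End fejer_kernel.

Section uniform_fibres.
Context (R : realType) (d d' : measure_display).
Context (X' : measurableType d') (X : measurableType d).
Context (m' : probability X' R) (m : probability X R) (p : X' -> X).
Hypothesis hp : measure_preserving m' m p.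
Context (th : X' -> R).
Hypothesis mth : measurable_fun setT th.
Hypothesis Hcos : forall k B, measurable B ->
  \int[m']_x (\1_B (p x) * cos (k.+1%:R * th x)) = 0.
Hypothesis Hsin : forall k B, measurable B ->
  \int[m']_x (\1_B (p x) * sin (k.+1%:R * th x)) = 0.

Let bcosk (r t : R) : bounded_measurable (fun x => cos (r * (th x - t))).
Proof. by apply: bmf_cos; apply: measurable_funM => //; exact: measurable_funB. Qed.

Let bB B : measurable B -> bounded_measurable (fun x => \1_B (p x) : R).
Proof. by move=> mB; exact: (Rintegral_mp hp (bmf_indic R mB)).1. Qed.

Let shifted_cos0 k t B : measurable B ->
  \int[m']_x (\1_B (p x) * cos (k.+1%:R * (th x - t))) = 0.
Proof.
move=> mB; set r := k.+1%:R.
transitivity (\int[m']_x (cos (r * t) * (\1_B (p x) * cos (r * th x)) +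
                          sin (r * t) * (\1_B (p x) * sin (r * th x)))).
  by apply: eq_Rintegral => x _; rewrite mulrBr cosB; ring.
have bc : bounded_measurable (fun x => \1_B (p x) * cos (r * th x)).
  by apply: bmfM; [exact: bB|apply: bmf_cos; exact: measurable_funM].
have bs : bounded_measurable (fun x => \1_B (p x) * sin (r * th x)).
  by apply: bmfM; [exact: bB|apply: bmf_sin; exact: measurable_funM].
rewrite RintegralD_bmf; [|by apply: bmfM => //; exact: bmf_cst..].
by rewrite !RintegralZ_bmf// Hcos// Hsin// !mulr0 addr0.
Qed.

Let kernel_int (i j : nat) t B : measurable B ->
  \int[m']_x (\1_B (p x) * cos ((i%:R - j%:R) * (th x - t))) =
  (i == j)%:R * fine (m B).
Proof.
move=> mB; case: (ltngtP i j) => ij.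
- rewrite mul0r -(shifted_cos0 (j - i.+1)%N t mB); apply: eq_Rintegral => x _.
  by rewrite -cosN -mulNr opprB -natrB ?(ltnW ij)// -subSn// subSS.
- rewrite mul0r -(shifted_cos0 (i - j.+1)%N t mB); apply: eq_Rintegral => x _.
  by rewrite -natrB ?(ltnW ij)// -subSn// subSS.
- rewrite mul1r ij; under eq_Rintegral do rewrite subrr mul0r cos0 mulr1.
  by rewrite (Rintegral_mp hp (bmf_indic R mB)).2 Rintegral_indic.
Qed.

Lemma measurable_box (L : nat) (t : R) (B : set X) : measurable B ->
  measurable [set x | B (p x) /\ L%:R * `|th x - t| <= pi / 4].
Proof.
move=> mB.
rewrite (_ : [set x | _] = p @^-1` B `\` [set x | pi / 4 < L%:R * `|th x - t|]).
  apply: measurableD.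
    exact: (mp_measurable hp).
  apply: measurable_ltr_set; first exact: measurable_cst.
  apply: measurable_funM => //; apply: measurableT_comp => //.
  exact: measurable_funB.
apply/seteqP; split=> x /=.
  by move=> [h1 h2]; split => //; apply/negP; rewrite -leNgt.
by move=> [h1 /negP]; rewrite -leNgt.
Qed.

(** The mean of [fejer L.+1 (th - t)] over the part of [X'] above [B] only sees its
    constant term and is [L.+1 * m B], whereas the kernel is at least
    [(L.+1 / 2) ^ 2] on the arc. *)
Lemma box_bound L t B : measurable B ->
  (m' [set x | B (p x) /\ (L.+1%:R * `|th x - t| <= pi / 4)%R] <=
    (4 / L.+1%:R)%:E * m B)%E.
Proof.
move=> mB; have mE := measurable_box L.+1 t mB; set E := [set x | _] in mE *.
have bK : bounded_measurable (fun x => fejer L.+1 (th x - t)).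
  under eq_fun do rewrite fejerE.
  by apply: bmf_sum => i; apply: bmf_sum => j.
have : \int[m']_x ((L.+1%:R / 2) ^+ 2 * \1_E x) <=
       \int[m']_x (\1_B (p x) * fejer L.+1 (th x - t)).
  apply: le_Rintegral_bmf.
  - by apply: bmfM; [exact: bmf_cst|exact: bmf_indic].
  - by apply: bmfM => //; exact: bB.
  move=> x; rewrite !indicE; have [xE|_] := boolP (x \in E).
    by have [h1 h2] := set_mem xE; rewrite mem_set// mulr1 mul1r fejer_ge.
  by rewrite mulr0 mulr_ge0// /fejer addr_ge0// sqr_ge0.
rewrite RintegralZ_bmf; last exact: bmf_indic.
rewrite Rintegral_indic//.
have -> : \int[m']_x (\1_B (p x) * fejer L.+1 (th x - t)) = L.+1%:R * fine (m B).
  under eq_Rintegral do rewrite fejerE mulr_sumr.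
  rewrite Rintegral_sum_bmf; last first.
    move=> i; apply: bmfM; first exact: bB.
    exact: bmf_sum.
  rewrite -[L.+1 in RHS]card_ord -sumr_const mulr_suml; apply: eq_bigr => i _.
  under eq_Rintegral do rewrite mulr_sumr.
  rewrite Rintegral_sum_bmf; last by move=> j; apply: bmfM => //; exact: bB.
  under eq_bigr do rewrite kernel_int//.
  rewrite (bigD1 i)//= eqxx big1 ?addr0// => j ji.
  by rewrite val_eqE eq_sym (negbTE ji) mul0r.
have f1 := fin_num_measure m' _ mE; have f2 := fin_num_measure m _ mB.
move=> h; rewrite -[m' E](fineK f1) -[m B](fineK f2) -EFinM lee_fin.
have l0 : 0 < L.+1%:R :> R by [].
have : (L.+1%:R / 4) * fine (m' E) <= fine (m B).
  rewrite -(ler_pM2l l0); apply: le_trans h; rewrite le_eqVlt; apply/orP; left.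
  by apply/eqP; field.
rewrite -ler_pdivlMl ?divr_gt0// => /le_trans; apply.
by rewrite invf_div.
Qed.

End uniform_fibres.

(** * Every law on the line is an image of Lebesgue measure *)

Section quantile.
Context (R : realType) (mu : probability R R).

Let F (t : R) : R := fine (mu `]-oo, t]%classic).

Let FE t : mu `]-oo, t]%classic = (F t)%:E.
Proof. by rewrite fineK// fin_num_measure. Qed.

Let F_homo s t : s <= t -> F s <= F t.
Proof.
move=> st; rewrite -lee_fin -!FE le_measure ?inE//.
exact: subitvPr.
Qed.

Let F0 t : 0 <= F t. Proof. by rewrite -lee_fin -FE. Qed.

Let F1 t : F t <= 1. Proof. by rewrite -lee_fin -FE; exact: probability_le1. Qed.

Let F_large u : u < 1 -> exists t, u < F t.
Proof.
move=> u1; have : mu `]-oo, n%:R]%classic @[n --> \oo] --> mu setT.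
  have <- : \bigcup_n `]-oo, (n%:R : R)]%classic = setT.
    apply/seteqP; split => // x _; exists (Num.truncn `|x|).+1 => //=.
    by rewrite in_itv/= (le_trans (ler_norm _))// ltW// truncnS_gt.
  apply: nondecreasing_cvg_mu => //.
    by apply: bigcupT_measurable => n.
  by move=> n k nk; apply/subsetPset; apply: subitvPr; rewrite bnd_simp ler_nat.
move=> c; apply: contrapT => h.
have : (mu setT <= u%:E)%E.
  apply: cvge_to_le c _; apply: nearW => n; rewrite FE lee_fin leNgt.
  by apply/negP => ?; apply: h; exists n%:R.
by rewrite probability_setT lee_fin leNgt u1.
Qed.

Let F_small u : 0 < u -> exists t, F t < u.
Proof.
move=> u0; have : mu `]-oo, (- n%:R)]%classic @[n --> \oo] --> 0%E.
  have <- : mu (\bigcap_n `]-oo, (- n%:R : R)]%classic) = 0%E.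
    rewrite -[RHS](measure0 mu); congr (mu _); apply/seteqP; split => // x h.
    have := h (Num.truncn `|x|).+1 I; rewrite /= in_itv/= lerNr => xn.
    have := truncnS_gt `|x|; rewrite ltNge (le_trans xn)//.
    by rewrite -normrN ler_norm.
  apply: nonincreasing_cvg_mu => //.
  - by rewrite (le_lt_trans (probability_le1 _ _))// ltry.
  - by apply: bigcapT_measurable => n.
  - move=> n k nk; apply/subsetPset; apply: subitvPr.
    by rewrite bnd_simp lerN2 ler_nat.
move=> c; apply: contrapT => h.
have : (u%:E <= 0)%E.
  apply: cvge_to_ge c _; apply: nearW => n; rewrite FE lee_fin leNgt.
  by apply/negP => ?; apply: h; exists (- n%:R).
by rewrite lee_fin leNgt u0.
Qed.

Definition quantile (u : R) : R := inf [set t | u < F t].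

Let quantile_lt u y : 0 < u < 1 ->
  quantile u < y <-> exists n, u < F (y - n.+1%:R^-1).
Proof.
move=> /andP[u0 u1]; split.
  move=> /inf_lt[|t ut ty]; first exact: F_large.
  have ty0 : 0 < y - t by rewrite subr_gt0.
  exists (Num.truncn (y - t)^-1); apply: lt_le_trans ut (F_homo _).
  rewrite lerBrDl -lerBrDr -[leRHS]invrK lef_pV2 ?posrE ?invr_gt0//.
  by rewrite ltW// truncnS_gt.
move=> [n un]; apply: (@le_lt_trans _ _ (y - n.+1%:R^-1)).
  apply: ge_inf => //; have [s Fs] := F_small u0.
  exists s => t /= ut; rewrite leNgt; apply/negP => /ltW /F_homo.
  by rewrite leNgt (lt_trans Fs).
by rewrite ltrBlDr ltrDl invr_gt0.
Qed.

Let D : set R := `]0, 1[%classic.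

Let mD : measurable D. Proof. exact: measurable_itv. Qed.

Let level y n : set R := [set u | 0 < u < 1 /\ u < F (y - n.+1%:R^-1)].

Let levelE y n : level y n = `]0, F (y - n.+1%:R^-1)[%classic `&` D.
Proof.
apply/seteqP; split => u; rewrite /level /D /= !in_itv /=.
  by move=> [/andP[-> ->] ->].
by move=> [/andP[? ?] /andP[? ?]]; split => //; apply/andP.
Qed.

Let measurable_level y n : measurable (level y n).
Proof. by rewrite levelE; apply: measurableI. Qed.

Let quantile_preimage y : D `&` [set u | quantile u < y] = \bigcup_n level y n.
Proof.
apply/seteqP; split => u; rewrite /D /= ?in_itv /=.
  by move=> [uD /(quantile_lt _ uD)[n h]]; exists n.
by move=> [n _ [uD h]]; split => //; apply/(quantile_lt _ uD); exists n.
Qed.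

Lemma measurable_quantile : measurable_fun D quantile.
Proof.
move=> _; apply: (measurability _ (RGenInftyO.measurableE R)) => //.
move=> _ [_ [y ->] <-]; rewrite (_ : _ `&` _ = \bigcup_n level y n).
  exact: bigcupT_measurable.
by rewrite -quantile_preimage; congr (_ `&` _).
Qed.

Let lebesgue_level y n : lebesgue_measure (level y n) = mu `]-oo, y - n.+1%:R^-1]%classic.
Proof.
rewrite FE levelE (_ : _ `&` _ = `]0, F (y - n.+1%:R^-1)[%classic).
  rewrite lebesgue_measure_itv /= lte_fin; case: ltP => [_|h]; first by rewrite oppr0 adde0.
  by congr EFin; apply/eqP; rewrite eq_le h F0.
apply/setIidPl => u; rewrite /D /= !in_itv/= => /andP[-> /lt_le_trans]; exact.
Qed.

(** Half lines determine a law, and the set where [quantile < y] is the increasing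
    union of the intervals [ ]0, F (y - 1 / n)[ ], where [F] is the distribution
    function of [mu]. *)
Lemma lebesgue_quantile (B : set R) : measurable B ->
  lebesgue_measure (D `&` quantile @^-1` B) = mu B.
Proof.
pose Q := quantile \_ D.
have mQ : measurable_fun setT Q.
  by apply/(measurable_restrictT _ mD); exact: measurable_quantile.
pose m1 := measure_function_pushforward__canonical__measure_function_Measure
  (mrestr (@lebesgue_measure R) mD) mQ.
have m1E (A : set R) : m1 A = lebesgue_measure (D `&` quantile @^-1` A).
  rewrite -[LHS]/(lebesgue_measure (Q @^-1` A `&` D)); congr lebesgue_measure.
  apply/seteqP; split => u.
    by move=> [/= + uD]; rewrite /Q patchE mem_set.
  by move=> [uD h]; split => //=; rewrite /Q patchE mem_set.
rewrite -m1E; move=> mB.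
apply: (measure_unique (@RGenInftyO.G R) (fun n => `]-oo, (n%:R : R)[%classic)
  _ _ _ _ m1 mu) => //.
- exact: RGenInftyO.measurableE.
- move=> _ _ [x ->] [y ->]; exists (Num.min x y).
  by apply/seteqP; split => z /=; rewrite !in_itv/= lt_min => /andP.
- by move=> n; exists n%:R.
- apply/seteqP; split => // x _; exists (Num.truncn `|x|).+1 => //=.
  by rewrite in_itv/= (le_lt_trans (ler_norm _))// truncnS_gt.
- move=> _ [y ->]; rewrite m1E.
  have -> : quantile @^-1` `]-oo, y[%classic = [set u | quantile u < y].
    by apply/seteqP; split => u /=; rewrite in_itv.
  rewrite quantile_preimage.
  have nd : nondecreasing_seq (level y).
    move=> n k nk; apply/subsetPset => u [uD h]; split => //.
    apply: lt_le_trans h (F_homo _); rewrite lerD2l lerN2 lef_pV2 ?posrE//.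
    by rewrite ler_nat ltnS.
  have c1 := nondecreasing_cvg_mu (mu := @lebesgue_measure R)
    (measurable_level y) (bigcupT_measurable _ (measurable_level y)) nd.
  pose G n := `]-oo, y - n.+1%:R^-1]%classic : set R.
  have GU : \bigcup_n G n = `]-oo, y[%classic.
    apply/seteqP; split => x.
      move=> [n _]; rewrite /G /= !in_itv/= => /le_lt_trans; apply.
      by rewrite ltrBlDr ltrDl invr_gt0.
    rewrite /= in_itv/= => xy; exists (Num.truncn (y - x)^-1) => //.
    rewrite /G /= in_itv/= lerBrDl -lerBrDr -[leRHS]invrK.
    have xy0 : 0 < y - x by rewrite subr_gt0.
    by rewrite lef_pV2 ?posrE ?invr_gt0// ltW// truncnS_gt.
  have c2 : mu (G n) @[n --> \oo] --> mu `]-oo, y[%classic.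
    rewrite -GU; apply: nondecreasing_cvg_mu => //.
    - by move=> n; exact: measurable_itv.
    - by apply: bigcupT_measurable => n; exact: measurable_itv.
    - move=> n k nk; apply/subsetPset; apply: subitvPr.
      rewrite bnd_simp lerD2l lerN2 lef_pV2 ?posrE//.
      by rewrite ler_nat ltnS.
  apply: cvg_unique c1 _ => //.
  rewrite (_ : _ \o _ = fun n => mu (G n)) //.
  by apply/funext => n; exact: lebesgue_level.
- move=> n; rewrite m1E (@le_lt_trans _ _ (lebesgue_measure D))//.
    apply: le_measure; rewrite ?inE//.
    by apply: measurable_quantile => //; exact: measurable_itv.
  by rewrite lebesgue_measure_itv /= lte_fin ltr01 oppr0 adde0 ltry.
Qed.

End quantile.

(** * Parametrizing a standard space by Lebesgue measure *)

Section standard_coordinate.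
Context (R : realType) (d : measure_display) (X : measurableType d).
Context (m : probability X R) (mu : probability R R) (phi : X -> R).
Context (X0 X1 : set X).
Hypothesis hphi : measure_preserving m mu phi.
Hypothesis inj : {in X0 &, injective phi}.
Hypothesis image_completed : forall A : set X, measurable A -> A `<=` X0 ->
  completed_algebra_gen mu (phi @` A).
Hypothesis mX1 : measurable X1.
Hypothesis X1_full : m X1 = 1%E.
Hypothesis X1_sub : X1 `<=` X0.

Let image_sandwich (A : set X) : measurable A -> A `<=` X1 ->
  exists B Z : set R, [/\ measurable B, measurable Z, mu Z = 0%E,
    B `<=` phi @` A & phi @` A `<=` B `|` Z].
Proof.
move=> mA AX1; have [B mB [N [Z [mZ Z0 NZ]] BN]] :=
  image_completed mA (subset_trans AX1 X1_sub).
exists B, Z; split => //; rewrite -BN; first exact: subsetUl.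
exact: setUS.
Qed.

Lemma left_inverse_exists : exists psi : R -> X, forall x, X1 x -> psi (phi x) = x.
Proof.
have [x0 X1x0] : X1 !=set0.
  apply/set0P/eqP => X10; move: X1_full; rewrite X10 measure0 => /esym/eqP.
  by rewrite onee_eq0.
have ex (y : R) : exists x, (phi @` X1) y -> X1 x /\ phi x = y.
  have [[x X1x <-]|h] := pselect ((phi @` X1) y); first by exists x.
  by exists x0 => /h.
have [psi hpsi] := choice ex; exists psi => x X1x.
have [|h1 h2] := hpsi (phi x); first by exists x.
by apply: inj => //; rewrite inE; exact: X1_sub.
Qed.

(** For rational [q], the image under [phi] of the part of [X1] where [h < q] is a
    Borel set up to a null set.  Removing these countably many null sets leaves a
    Borel set on which [h \o psi] is Borel. *)
Lemma measurable_left_inverse (psi : R -> X) (h : X -> R) :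
  (forall x, X1 x -> psi (phi x) = x) -> measurable_fun setT h ->
  exists Y : set R, [/\ measurable Y, mu Y = 1%E, Y `<=` phi @` X1 &
    measurable_fun Y (h \o psi)].
Proof.
move=> hpsi mh.
pose A (q : rat) := X1 `&` [set x | h x < ratr q].
have mA q : measurable (A q).
  by apply: measurableI => //; apply: measurable_ltr_set => //; exact: measurable_cst.
have [B hB] := choice (fun q => image_sandwich (mA q) (@subIsetl _ _ _)).
have [Z hBZ] := choice hB.
have [B1 [Z1 [mB1 mZ1 Z10 B1s B1Z1]]] := image_sandwich mX1 (@subset_refl _ X1).
pose Zs := \bigcup_(q : rat) Z q.
have mZs : measurable Zs by apply: bigcupT_measurable_rat => q; have [] := hBZ q.
have Zs0 : mu.-negligible Zs.
  (* a union over the rationals, indexed by their codes *)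
  apply: (negligibleS _ (negligible_bigcup (F := fun n => if unpickle n is Some q then Z q else set0) _)).
    by move=> y [q _ yZ]; exists (pickle q); [exact: I|rewrite pickleK].
  move=> n; case: (unpickle n) => [q|]; last exact: negligible_set0.
  by have [_ mZ Z0 _ _] := hBZ q; apply/(negligibleP mu mZ).
have mY : measurable (B1 `\` Zs) by exact: measurableD.
exists (B1 `\` Zs); split => //.
- have full : mu (B1 `|` Z1) = 1%E.
    have mBZ : measurable (B1 `|` Z1) by exact: measurableU.
    apply/eqP; rewrite eq_le probability_le1//= -X1_full -hphi.2//.
    apply: le_measure; rewrite ?inE//.
      exact: (mp_measurable hphi).
    by move=> x X1x; apply: B1Z1; exists x.
  have : (mu (B1 `|` Z1) <= mu (B1 `\` Zs) + mu (Z1 `|` Zs))%E.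
    apply: le_trans (measureU2 _ _ _) => //; last exact: measurableU.
    apply: le_measure; rewrite ?inE//.
    + exact: measurableU.
    + by apply: measurableU => //; exact: measurableU.
    + move=> y [yB|yZ]; last by right; left.
      by have [yZs|yZs] := pselect (Zs y); [right; right|left].
  rewrite full (_ : mu (Z1 `|` Zs) = 0%E) ?adde0; last first.
    apply/(negligibleP mu (measurableU _ _ mZ1 mZs)).
    by apply: negligibleU => //; apply/(negligibleP mu mZ1).
  by move=> h1; apply/eqP; rewrite eq_le probability_le1.
- by move=> y [/B1s].
move=> _; apply: (measurability _ (RGenInftyO.measurableE R)) => //.
move=> _ [_ [c ->] <-].
rewrite (_ : _ `&` _ = (B1 `\` Zs) `&` \bigcup_(q : rat)
    (if ratr q < c :> R then B q else set0)).
  apply: measurableI => //; apply: bigcupT_measurable_rat => q.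
  by case: ifP => // _; have [] := hBZ q.
have psiE q y : (B1 `\` Zs) y -> B q y <-> h (psi y) < ratr q.
  move=> [yB1 yZs]; have [_ _ _ Bq1 Bq2] := hBZ q.
  have [x X1x xy] := B1s _ yB1; split.
    by move=> /Bq1[z [X1z hz] <-]; rewrite hpsi.
  rewrite -xy hpsi// => hx; have [//|Zy] := Bq2 _ (ex_intro2 _ _ x (conj X1x hx) xy).
    by rewrite xy.
  by exfalso; apply: yZs; exists q.
apply/seteqP; split => y [yY].
  rewrite /= in_itv /= => /rat_in_itvoo [q]; rewrite in_itv/= => /andP[hq qc].
  by split => //; exists q => //; rewrite qc; apply/psiE.
move=> [q _]; case: ifP => // qc /(psiE _ _ yY) hq; split => //=.
by rewrite in_itv /= (lt_trans hq).
Qed.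

(** The map [w] is the inverse of the coordinate of the standard space composed
    with a quantile function of its image law, restricted to where it is well
    behaved with respect to [p] and [t].  It transports questions on [X] to
    Lebesgue measure, for which Lusin's theorem can be used. *)
Lemma lebesgue_model (p t : X -> R) :
  measurable_fun setT p -> measurable_fun setT t ->
  exists (D : set R) (w : R -> X),
  [/\ measurable D, lebesgue_measure D = 1%E, forall u, D u -> X1 (w u),
      measurable_fun D (p \o w) /\ measurable_fun D (t \o w) &
      forall A I : set R, measurable A -> measurable I ->
        (lebesgue_measure (D `&` [set u | A (p (w u)) /\ I (t (w u))]) <=
         m [set x | A (p x) /\ I (t x)])%E].
Proof.
move=> mp mt; have [psi hpsi] := left_inverse_exists.
have [Yp [mYp Yp1 Yps Ypf]] := measurable_left_inverse hpsi mp.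
have [Yt [mYt Yt1 Yts Ytf]] := measurable_left_inverse hpsi mt.
pose Y := Yp `&` Yt; have mY : measurable Y by exact: measurableI.
have Y1 : mu Y = 1%E.
  apply/eqP; rewrite eq_le probability_le1//= -Yp1.
  have : (mu Yp <= mu Y + mu (~` Yt))%E.
    apply: le_trans (measureU2 _ _ _) => //; last exact: measurableC.
    apply: le_measure; rewrite ?inE//.
      by apply: measurableU => //; exact: measurableC.
    by move=> y yp; have [|] := pselect (Yt y); [left|right].
  by rewrite probability_setC// Yt1 subee// adde0.
pose I01 : set R := `]0, 1[%classic.
pose Q := quantile mu.
have mI : measurable I01 by exact: measurable_itv.
have mQ : measurable_fun I01 Q := measurable_quantile mu.
have mD : measurable (I01 `&` Q @^-1` Y) by exact: mQ.
have sY u : Y u -> X1 (psi u).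
  by move=> [/Yps [x X1x <-] _]; rewrite hpsi.
have comp (h : X -> R) : measurable_fun Y (h \o psi) ->
    measurable_fun (I01 `&` Q @^-1` Y) (h \o (psi \o Q)).
  move=> mh; rewrite compA; apply: (measurable_comp mY) => //.
    by move=> _ [u [_ Yu] <-].
  by apply: measurable_funS mQ => //; exact: subIsetl.
exists (I01 `&` Q @^-1` Y), (psi \o Q); split => //.
- by rewrite lebesgue_quantile.
- by move=> u [_ /sY].
- split; apply: comp.
    by apply: measurable_funS Ypf => //; exact: subIsetl.
  by apply: measurable_funS Ytf => //; exact: subIsetr.
move=> A I mA mI'.
pose Y2 := Y `&` ((p \o psi) @^-1` A `&` (t \o psi) @^-1` I).
have mY2 : measurable Y2.
  rewrite /Y2 setIIr; apply: measurableI.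
    by have := measurable_funS mYp (@subIsetl _ Yp Yt) Ypf; exact.
  by have := measurable_funS mYt (@subIsetr _ Yp Yt) Ytf; exact.
rewrite (_ : _ `&` _ = I01 `&` Q @^-1` Y2); last first.
  by rewrite -setIA.
rewrite lebesgue_quantile// -hphi.2//.
have mphi : measurable (phi @^-1` Y2).
  exact: (mp_measurable hphi).
have mE : measurable [set x | A (p x) /\ I (t x)].
  by rewrite -[X in measurable X]setTI setTI; apply: measurableI;
    rewrite -[X in measurable X]setTI; [exact: mp|exact: mt].
have X1c : m (~` X1) = 0%E by rewrite probability_setC// X1_full subee.
apply: (@le_trans _ _ (m [set x | A (p x) /\ I (t x)] + m (~` X1))%E); last first.
  by rewrite X1c adde0.
apply: le_trans (measureU2 _ _ _) => //; last exact: measurableC.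
apply: le_measure; rewrite ?inE//; first by apply: measurableU => //; exact: measurableC.
move=> x [_ [/= hA hI]]; have [X1x|] := pselect (X1 x); last by right.
by left; move: hA hI; rewrite hpsi.
Qed.

End standard_coordinate.

(** * Countable fibres are not uniform *)

(** Lusin's theorem yields compact sets of measure more than 1/2 on which [P],
    respectively [Q], is continuous; these sets meet in positive measure. *)
Lemma compact_measurable_image (R : realType) (D : set R) (P Q : R -> R) :
  measurable D -> lebesgue_measure D = 1%E ->
  measurable_fun D P -> measurable_fun D Q ->
  exists K : set R, [/\ compact K, K `<=` D, (0 < lebesgue_measure K)%E &
    compact [set (P u, Q u) | u in K]].
Proof.
move=> mD D1 mP mQ; have Dfin : (lebesgue_measure D < +oo)%E by rewrite D1 ltry.
have e0 : 0 < 2^-1 :> R by [].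
have [K1 [cK1 K1D K1e cP]] := measurable_almost_continuous mD Dfin e0 mP.
have [K2 [cK2 K2D K2e cQ]] := measurable_almost_continuous mD Dfin e0 mQ.
have clK2 : closed K2 by apply: compact_closed => //; exact: Rhausdorff.
have cK : compact (K1 `&` K2) by exact: compact_closedI.
have mK1 := compact_measurable cK1; have mK2 := compact_measurable cK2.
exists (K1 `&` K2); split => //; first by move=> u [/K1D].
- rewrite lt_neqAle measure_ge0 andbT; apply/negP => /eqP K0.
  have : (lebesgue_measure D <= lebesgue_measure (K1 `&` K2) +
      (lebesgue_measure (D `\` K1) + lebesgue_measure (D `\` K2)))%E.
    apply: (@le_trans _ _ (lebesgue_measure ((K1 `&` K2) `|` ((D `\` K1) `|` (D `\` K2))))).
      apply: le_measure; rewrite ?inE//.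
        apply: measurableU; first exact: measurableI.
        by apply: measurableU; exact: measurableD.
      move=> u Du; have [h1|h1] := pselect (K1 u); last by right; left.
      by have [h2|h2] := pselect (K2 u); [left|right; right].
    apply: le_trans (measureU2 _ _ _) _; [exact: measurableI|by apply: measurableU; exact: measurableD|].
    by apply: leeD => //; apply: measureU2; exact: measurableD.
  rewrite -K0 add0e D1 leNgt => /negP; apply.
  by apply: lt_le_trans (lteD K1e K2e) _; rewrite -EFinD lee_fin; lra.
apply: continuous_compact cK.
have cP' : {within K1 `&` K2, continuous P}.
  by apply: continuous_subspaceW cP; exact: subIsetl.
have cQ' : {within K1 `&` K2, continuous Q}.
  by apply: continuous_subspaceW cQ; exact: subIsetr.
by move=> u; exact: (cvg_pair (cP' u) (cQ' u)).
Qed.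

Section no_uniform_fibres.
Context (R : realType) (d d' : measure_display).
Context (X' : measurableType d') (X : measurableType d).
Context (m' : probability X' R) (m : probability X R) (pi : X' -> X).
Hypothesis hm' : standard_probability m'.
Hypothesis hm : standard_probability m.
Hypothesis hpi : measure_preserving m' m pi.
Hypothesis hfib : forall x : X, countable (pi @^-1` [set x]).
Context (tau : X' -> R) (kappa : R).
Hypothesis mtau : measurable_fun setT tau.
Hypothesis tau01 : forall x, 0 <= tau x < 1.

Let J n j : set R := `[j%:R / (2 ^ n)%:R, j.+1%:R / (2 ^ n)%:R[%classic.

Hypothesis box : forall n j B, measurable B ->
  (m' [set x | B (pi x) /\ J n j (tau x)] <= (kappa / (2 ^ n)%:R)%:E * m B)%E.

(** Let [C] be the compact image of [K] under [pi], read in the coordinate of [X],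
    and [tau].  That coordinate is injective, so the vertical sections of [C]
    are images of subsets of fibres of [pi]: they are countable, and the product
    of the law of the coordinate with Lebesgue measure does not charge [C].  Now
    [C] is approximated from outside by the decreasing sets [V n], finite unions of
    boxes over dyadic intervals.  The hypothesis [box] bounds the measure of [K] by
    [kappa] times the product measure of [V n], which tends to 0. *)
Lemma countable_fibres_not_uniform : False.
Proof.
have [mu' [phi' [X0' [hphi' mX0' X0'1 inj' im']]]] := hm'.
have [mu [phi [X0 [hphi mX0 X01 inj _]]]] := hm.
pose X1 := X0' `&` pi @^-1` X0.
have mpX0 : measurable (pi @^-1` X0).
  exact: (mp_measurable hpi).
have mX1 : measurable X1 by exact: measurableI.
have X11 : m' X1 = 1%E.
  apply/eqP; rewrite eq_le probability_le1//= -X0'1.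
  have : (m' X0' <= m' X1 + m' (~` (pi @^-1` X0)))%E.
    apply: le_trans (measureU2 _ _ _) => //; last exact: measurableC.
    apply: le_measure; rewrite ?inE//.
      by apply: measurableU => //; exact: measurableC.
    by move=> y yp; have [|] := pselect ((pi @^-1` X0) y); [left|right].
  by rewrite probability_setC// hpi.2// X01 subee// adde0.
have mp : measurable_fun setT (phi \o pi).
  by apply: measurableT_comp; [case: hphi|case: hpi].
have [D [w [mD D1 DX1 [mP mQ] law]]] :=
  lebesgue_model hphi' inj' im' mX1 X11 (@subIsetl _ _ _) mp mtau.
set P := _ \o w in mP; set Q := _ \o w in mQ.
have [K [cK KD K0 cC]] := compact_measurable_image mD D1 mP mQ.
set C := [set _ | _ in _] in cC.
have mK := compact_measurable cK.
pose I n j : set R := `[j%:R / (2 ^ n)%:R, j.+1%:R / (2 ^ n)%:R]%classic.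
pose A n j : set R := [set z.1 | z in C `&` (setT `*` I n j)].
have mA n j : measurable (A n j).
  apply: compact_measurable; apply: continuous_compact.
    by apply: continuous_subspaceT => z; exact: cvg_fst.
  apply: compact_closedI => //.
  rewrite (_ : _ `*` _ = snd @^-1` I n j); last first.
    by apply/seteqP; split => z //= -[].
  apply: preimage_closed; first by move=> z _; exact: cvg_snd.
  exact: itv_closed.
have N0 n : 0 < (2 ^ n)%:R :> R by rewrite ltr0n expn_gt0.
have JE n j t : J n j t <-> j%:R <= t * (2 ^ n)%:R < j.+1%:R.
  by rewrite /J /= in_itv /= ler_pdivrMr// ltr_pdivlMr.
have IE n j t : I n j t <-> j%:R <= t * (2 ^ n)%:R <= j.+1%:R.
  by rewrite /I /= in_itv /= ler_pdivrMr// ler_pdivlMr.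
have AE n j s : A n j s <-> exists u, [/\ K u, P u = s & I n j (Q u)].
  split=> [[_ [[u Ku <-] [_ /= Iu]] <-]|[u [Ku <- Iu]]]; first by exists u.
  by exists (P u, Q u) => //; split => //; exists u.
pose V n := \big[setU/set0]_(j < 2 ^ n) (A n j `*` J n j).
have VE n s t : V n (s, t) <-> exists2 j, (j < 2 ^ n)%N & A n j s /\ J n j t.
  rewrite /V -(bigcup_mkord _ (fun j => A n j `*` J n j)).
  by split=> [[j /= jn [h1 h2]]|[j jn [h1 h2]]]; exists j.
have mJ n j : measurable (J n j) by exact: measurable_itv.
have mAJ n j : measurable (A n j `*` J n j) by exact: measurableX.
have mV n : measurable (V n) by apply: bigsetU_measurable => j _.
pose nu : {measure set _ -> \bar R} := (mu \x @lebesgue_measure R)%E.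
have lJ n j : lebesgue_measure (J n j) = ((2 ^ n)%:R^-1)%:E.
  rewrite /J lebesgue_measure_itv /= lte_fin ltr_pM2r ?invr_gt0//.
  by rewrite ltr_nat ltnSn -EFinB -mulrBl -natr1 addrAC subrr add0r mul1r.
have nuV n : nu (V n) = (\sum_(j < 2 ^ n) mu (A n j) * ((2 ^ n)%:R^-1)%R%:E)%E.
  rewrite /V (measure_semi_additive_ord nu); last 3 first.
  - by move=> k; exact: mAJ.
  - apply/trivIsetP => i j _ _ ij; apply/seteqP; split => // -[s t] [[_ /= /JE hi] [_ /= /JE hj]].
    move/eqP: ij; apply; apply/val_inj.
    by rewrite /= -(truncn_def hi) (truncn_def hj).
  - exact: mV.
  apply: eq_bigr => j _; rewrite [LHS]product_measure1E; [congr (_ * _)%E; exact: lJ|exact: mA|exact: mJ].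
have Vdecr : nonincreasing_seq V.
  apply/nonincreasing_seqP => n; apply/subsetPset => -[s t] /VE [j jn [/AE[u [Ku Pu /IE Iu]] /JE Jt]].
  have jh : (j./2.*2 <= j <= j./2.*2.+1)%N by lia.
  have jh1 : (j./2)%:R * 2 <= j%:R :> R by rewrite -natrM ler_nat; lia.
  have jh2 : j.+1%:R <= (j./2).+1%:R * 2 :> R by rewrite -natrM ler_nat; lia.
  move: Iu Jt; rewrite expnS natrM => /andP[I1 I2] /andP[J1 J2].
  apply/VE; exists j./2; first by move: jn; rewrite expnS; lia.
  by split; [apply/AE; exists u; split => //; apply/IE|apply/JE]; apply/andP; split; lra.
have slice_closed s : closed [set Q u | u in K `&` [set u | P u = s]].
  have -> : [set Q u | u in K `&` [set u | P u = s]] = [set z.2 | z in C `&` (fst @^-1` [set s])].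
    apply/seteqP; split=> t.
      by move=> [u [Ku Pu] <-]; exists (P u, Q u) => //; split => //; exists u.
    by move=> [_ [[u Ku <-] /= Pu] <-]; exists u.
  apply: compact_closed; first exact: Rhausdorff.
  apply: continuous_compact.
    by apply: continuous_subspaceT => z; exact: cvg_snd.
  apply: compact_closedI => //; apply: preimage_closed.
    by move=> z _; exact: cvg_fst.
  exact: closed_eq.
have VC s t : (forall n, V n (s, t)) -> [set Q u | u in K `&` [set u | P u = s]] t.
  move=> Vn; apply: contrapT => tn.
  have : nbhs t (~` [set Q u | u in K `&` [set u | P u = s]]).
    by apply: open_nbhs_nbhs; split => //; exact: closed_openC.
  move=> /nbhs_ballP[e /= e0 he].
  pose n := (Num.truncn e^-1).+1.
  have ne : (2 ^ n)%:R^-1 < e.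
    rewrite -[ltRHS]invrK ltf_pV2 ?posrE ?invr_gt0//.
    apply: lt_trans (truncnS_gt _) _; rewrite ltr_nat; exact: ltn_expl.
  have /VE[j jn [/AE[u [Ku Pu /IE/andP[I1 I2]]] /JE/andP[J1 J2]]] := Vn n.
  apply: (he (Q u)); last by exists u.
  rewrite /ball /= (le_lt_trans _ ne)// -(ler_pM2r (N0 n)) mulVf ?gt_eqF//.
  rewrite -[X in _ * X](ger0_norm (ltW (N0 n))) -normrM ler_norml.
  by rewrite -natr1 in I2 J2; apply/andP; split; lra.
have mW : measurable (\bigcap_n V n) by exact: bigcapT_measurable.
have W0 : nu (\bigcap_n V n) = 0%E.
  rewrite /nu /product_measure1; apply: integral0_eq => s _ /=.
  apply: countable_lebesgue_measure0.
  have [[u0 [Ku0 Pu0]]|nos] := pselect (exists u, K u /\ P u = s); last first.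
    rewrite (_ : xsection _ s = set0); first exact: countable0.
    apply/seteqP; split => // t; rewrite /xsection /= inE => Vt; apply: nos.
    have [u [Ku Pu] _] := VC s t (fun n => Vt n Logic.I).
    by exists u.
  apply: sub_countable (hfib (pi (w u0))).
  apply: card_le_trans (card_image_le tau _); apply: subset_card_le.
  move=> t; rewrite /xsection /= inE => Vt.
  have [u [Ku Pu] <-] := VC s t (fun n => Vt n Logic.I).
  exists (w u) => //=; apply: inj.
  - by rewrite inE; case: (DX1 u (KD _ Ku)).
  - by rewrite inE; case: (DX1 u0 (KD _ Ku0)).
  - by rewrite -[LHS]/(P u) -[RHS]/(P u0) Pu.
have c0 : nu (V n) @[n --> \oo] --> 0%E.
  rewrite -W0; apply: nonincreasing_cvg_mu => //.
  rewrite nuV expn0 big_ord1 invr1 mule1.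
  by rewrite (le_lt_trans (probability_le1 _ _))// ltry.
have key n : (lebesgue_measure K <= kappa%:E * nu (V n))%E.
  pose E j := D `&` [set u | A n j (P u) /\ J n j (Q u)].
  have mE j : measurable (E j).
    rewrite (_ : E j = (D `&` P @^-1` A n j) `&` (D `&` Q @^-1` J n j)).
      by apply: measurableI; [exact: mP|exact: mQ].
    by rewrite -setIIr.
  have KE : K `<=` \big[setU/set0]_(j < 2 ^ n) E j.
    move=> u Ku; rewrite -bigcup_mkord.
    have /andP[q0 q1] := tau01 (w u).
    have t0 : 0 <= Q u * (2 ^ n)%:R by apply: mulr_ge0 => //; exact: ltW.
    have /andP[h1 h2] := truncn_itv t0.
    exists (Num.truncn (Q u * (2 ^ n)%:R)) => /=.
      rewrite -(ltr_nat R); apply: le_lt_trans h1 _.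
      by rewrite -[ltRHS]mul1r ltr_pM2r.
    split; first exact: KD.
    split; last by apply/JE/andP.
    by apply/AE; exists u; split => //; apply/IE/andP; split => //; exact: ltW.
  apply: (@le_trans _ _ (\sum_(j < 2 ^ n) lebesgue_measure (E j))%E).
    have B := Boole_inequality (@lebesgue_measure R) (n := (2 ^ n)%N) (fun i _ => mE i).
    apply: le_trans B.
    apply: le_measure; rewrite ?inE; [exact: mK| |exact: KE].
    by apply: bigsetU_measurable => j _; exact: mE.
  rewrite nuV ge0_sume_distrr//; last by move=> j _; exact: mule_ge0.
  apply: lee_sum => j _; apply: le_trans (law _ _ (mA n j) (mJ n j)) _.
  have mphiA : measurable (phi @^-1` A n j).
    exact: (mp_measurable hphi).
  apply: le_trans (box n j mphiA) _.
  by rewrite hphi.2// EFinM -muleA [X in (_ * X)%E]muleC.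
have : (lebesgue_measure K <= 0)%E.
  have c1 : (kappa%:E * nu (V n))%E @[n --> \oo] --> 0%E.
    by rewrite -[X in _ --> X](mule0 kappa%:E); apply: cvgeZl.
  by apply: cvge_to_ge c1 _; apply: nearW => n; exact: key.
by rewrite leNgt K0.
Qed.

End no_uniform_fibres.

(** * Descent of periodicity *)

Section periodic_descent.
Context (R : realType) (d d' : measure_display).
Context (X' : measurableType d') (m' : probability X' R) (T' : X' -> X').
Context (X : measurableType d) (m : probability X R) (T : X -> X).
Context (p : X' -> X) (f : X -> R).
Hypothesis hT' : measure_preserving m' m' T'.
Hypothesis hm : standard_probability m.
Hypothesis hm' : standard_probability m'.
Hypothesis hT : ergodic m T.
Hypothesis hp : measure_preserving m' m p.
Hypothesis hfib : forall x : X, countable (p @^-1` [set x]).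
Hypothesis hcomm : T \o p = p \o T'.
Hypothesis mf : measurable_fun setT f.

(** Otherwise [tau], the fractional part of [g / lambda], contradicts
    [countable_fibres_not_uniform]: a dyadic interval of length [2^-n] corresponds
    to an arc of length [2 pi / 2^n], on which [box_bound] applies to a sum of
    [2^(n-2)] terms and gives the constant 16. *)
Lemma not_all_fourier_vanish (g : X' -> R) (lambda : R) :
  measurable_fun setT g -> 0 < lambda ->
  ~ (forall k B, measurable B ->
      \int[m']_x (\1_B (p x) * cos (k.+1%:R * (pi *+ 2 / lambda) * g x)) = 0 /\
      \int[m']_x (\1_B (p x) * sin (k.+1%:R * (pi *+ 2 / lambda) * g x)) = 0).
Proof.
move=> mg l0 vanish.
pose fl x := Num.floor (g x / lambda).
pose tau x := g x / lambda - (fl x)%:~R.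
have mgl : measurable_fun setT (fun x => g x / lambda) by exact: measurable_funM.
have mfl : measurable_fun setT (fun x => (fl x)%:~R : R).
  move=> _ Y mY; rewrite setTI.
  exact: (measurable_floor_preimage [set k : int | Y k%:~R] mgl).
have mtau : measurable_fun setT tau by exact: measurable_funB.
have tau01 x : 0 <= tau x < 1.
  have /andP[h1 h2] := floor_itv (g x / lambda).
  by rewrite intrD in h2; rewrite /tau /fl; apply/andP; split; lra.
have shift k x : k.+1%:R * (pi *+ 2 * tau x) =
    k.+1%:R * (pi *+ 2 / lambda) * g x + pi *+ 2 * (- (k.+1%:Z * fl x))%:~R.
  by rewrite /tau mulrNz intrM -pmulrn; ring.
have mth : measurable_fun setT (fun x => pi *+ 2 * tau x) by exact: measurable_funM.
apply: (countable_fibres_not_uniform hm' hm hp hfib (kappa := 16) mtau tau01) => n j B mB.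
have mpB : measurable (p @^-1` B).
  exact: (mp_measurable hp).
pose J : set R := `[j%:R / (2 ^ n)%:R, j.+1%:R / (2 ^ n)%:R[%classic.
have mE : measurable [set x | B (p x) /\ J (tau x)].
  apply: measurableI => //; rewrite -[X in measurable X]setTI.
  by apply: mtau => //; exact: measurable_itv.
have N0 : 0 < (2 ^ n)%:R :> R by rewrite ltr0n expn_gt0.
(* below level 2 the bound to prove exceeds [m B] *)
have [n2|n2] := ltnP n 2.
  apply: (@le_trans _ _ (m B)).
    by rewrite -hp.2//; apply: le_measure; rewrite ?inE// => x [].
  rewrite -[leLHS]mul1e lee_wpmul2r// lee_fin ler_pdivlMr// mul1r.
  by rewrite ler_nat; case: n n2 {J mE N0} => [|[|]].
have e2n : (2 ^ n = 4 * 2 ^ (n - 2))%N by rewrite -[4%N]/(2 ^ 2)%N -expnD subnKC.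
have L1 : (2 ^ (n - 2)).-1.+1 = (2 ^ (n - 2))%N by rewrite prednK// expn_gt0.
have := box_bound hp mth _ _ (2 ^ (n - 2)).-1 (pi *+ 2 * ((j%:R + 2^-1) / (2 ^ n)%:R)) mB.
rewrite L1.
have M0 : 0 < (2 ^ (n - 2))%:R :> R by rewrite ltr0n expn_gt0.
have eN : (2 ^ n)%:R = 4 * (2 ^ (n - 2))%:R :> R by rewrite e2n natrM.
have -> : 4 / (2 ^ (n - 2))%:R = 16 / (2 ^ n)%:R :> R.
  by rewrite eN; field; rewrite gt_eqF.
move=> bound; apply: le_trans (bound _ _).
- apply: le_measure; rewrite ?inE//.
    exact: (measurable_box hp mth).
  move=> x [Bx]; rewrite /J /= in_itv /= ler_pdivrMr// ltr_pdivlMr// => /andP[h1 h2].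
  split => //; rewrite -mulrBr normrM ger0_norm; last by rewrite mulrn_wge0// pi_ge0.
  have h : `|tau x - (j%:R + 2^-1) / (2 ^ n)%:R| <= (2 ^ n)%:R^-1 / 2.
    rewrite -(ler_pM2r N0) -[X in _ * X <= _](ger0_norm (ltW N0)) -normrM mulrBl.
    rewrite divfK ?gt_eqF// mulrAC mulVf ?gt_eqF// mul1r.
    by rewrite -natr1 in h2; rewrite ler_norml; apply/andP; split; lra.
  apply: (@le_trans _ _ ((2 ^ (n - 2))%:R * (pi *+ 2 * ((2 ^ n)%:R^-1 / 2)))).
    by rewrite ler_pM2l// ler_wpM2l// mulrn_wge0// pi_ge0.
  by rewrite eN le_eqVlt; apply/orP; left; apply/eqP; field; rewrite gt_eqF.
- move=> k B' mB'; rewrite -[RHS](vanish k B' mB').1; apply: eq_Rintegral => x _.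
  by rewrite shift cosDint.
- move=> k B' mB'; rewrite -[RHS](vanish k B' mB').2; apply: eq_Rintegral => x _.
  by rewrite shift sinDint.
Qed.

(** By ergodicity, each conditional Fourier coefficient of [g] given [pi] vanishes
    almost everywhere or almost nowhere, since its modulus is invariant.  One that
    vanishes almost nowhere makes [f] periodic, and they cannot all vanish
    almost everywhere. *)
Lemma periodic_descent : periodic_for m' T' (f \o p) -> periodic_for m T f.
Proof.
move=> [rho [g [lambda [q [mg l0 mq fg]]]]].
have p0 : 0 < pi *+ 2 :> R by rewrite pmulrn_lgt0// pi_gt0.
pose a k : R := k.+1%:R * (pi *+ 2 / lambda).
have a0 k : 0 < a k by rewrite mulr_gt0// divr_gt0.
pose b k x := a k * (f x - rho).
have mb k : measurable_fun setT (b k).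
  by apply: measurable_funM => //; exact: measurable_funB.
have mag k : measurable_fun setT (fun x => a k * g x) by exact: measurable_funM.
have gT : {ae m', forall x, forall k,
    a k * g (T' x) = a k * g x - b k (p x) + pi *+ 2 * (k.+1%:Z * q x)%:~R}.
  apply: filterS fg => x /= fx k; rewrite /b fx intrM -pmulrn /a.
  by field; rewrite gt_eqF.
apply: contrapT => nper; apply: (not_all_fourier_vanish mg l0) => k B mB.
have [C [bC hC]] := conditional_expectation_exists hp (proj1 (bmf_cos (mag k)))
  (fun x => cos_max _).
have [S [bS hS]] := conditional_expectation_exists hp (proj1 (bmf_sin (mag k)))
  (fun x => sin_max _).
have eqv : {ae m, forall x,
    C (T x) = C x * cos (b k x) + S x * sin (b k x) /\
    S (T x) = S x * cos (b k x) - C x * sin (b k x)}.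
  apply: (conditional_expectation_equivariant hT' hT.1 hp hcomm
    (bmf_cos (mag k)) (bmf_sin (mag k)) (mb k) _ _ bC bS hC hS).
    by apply: filterS gT => x ->; rewrite cosDint cosB.
  by apply: filterS gT => x ->; rewrite sinDint sinB.
have [mC _] := bC; have [mS _] := bS.
pose N x := C x ^+ 2 + S x ^+ 2.
have mN : measurable [set x | 0 < N x].
  apply: measurable_ltr_set; first exact: measurable_cst.
  by apply: measurable_funD; exact: measurable_funX.
have CS0 : {ae m, forall x, C x = 0 /\ S x = 0}.
  have [|N0|pos] := ergodic_ae_invariant hT mN.
  - apply: filterS eqv => x [eC eS] /=; rewrite /N eC eS.
    have := cos2Dsin2 (b k x); set co := cos _; set si := sin _ => h.
    have -> : (C x * co + S x * si) ^+ 2 + (S x * co - C x * si) ^+ 2 =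
      (C x ^+ 2 + S x ^+ 2) * (co ^+ 2 + si ^+ 2) by ring.
    by rewrite h mulr1.
  - apply: filterS N0 => x /negP; rewrite -leNgt => h.
    have : N x == 0 by rewrite eq_le h addr_ge0// sqr_ge0.
    by rewrite /N paddr_eq0 ?sqr_ge0// !sqrf_eq0 => /andP[/eqP -> /eqP ->].
  - exfalso; apply: nper.
    exact: (periodic_of_equivariant hT.1.1 mf (a0 k) mC mS eqv pos).
have bB := bmf_indic R mB.
have z : \int[m]_x (0 : R) = 0 by rewrite Rintegral_cst// mul0r.
have b0 : bounded_measurable (fun=> 0 : R) := bmf_cst X 0.
split; [rewrite hC//|rewrite hS//]; rewrite -[RHS]z;
  (apply: ae_eq_Rintegral => //; first exact: bmfM).
- by apply: filterS CS0 => x [-> _]; rewrite mulr0.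
- by apply: filterS CS0 => x [_ ->]; rewrite mulr0.
Qed.

End periodic_descent.

(** * The theorem *)

(* The last implication is false without the assumption that m' is standard:
   X' may then be a non-measurable subset of a circle extension of X. *)
Theorem theorem1p4 (R : realType) (d d' : measure_display)
    (X' : measurableType d') (m' : probability X' R) (T' : X' -> X')
    (X : measurableType d) (m : probability X R) (T : X -> X)
    (pi : X' -> X) (f : X -> R)
    (hT' : measure_preserving m' m' T')
    (hm : standard_probability m)
    (hT : ergodic m T)
    (hpi : measure_preserving m' m pi)
    (hfib : forall x : X, countable (pi @^-1` [set x]))
    (hcomm : T \o pi = pi \o T')
    (hf : measurable_fun setT f) :
  (coboundary m T f <-> coboundary m' T' (f \o pi)) /\
  ((aperiodic_for m' T' (f \o pi) -> aperiodic_for m T f) /\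
   (standard_probability m' ->
    aperiodic_for m T f -> aperiodic_for m' T' (f \o pi))).
Proof.
have mpT : measure_preserving m m T := hT.1.
split; first split.
- exact: coboundary_comp hpi hcomm.
- exact: coboundary_descent hT' mpT hpi hcomm hf.
split=> [aper per|hm' aper per]; apply: aper.
- exact: periodic_comp hpi hcomm per.
- exact: (periodic_descent hT' hm hm' hT hpi hfib hcomm hf per).
Qed.
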